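(* Let $Y=V\times W$ with $V=k^r$ and $W=(k^\times)^s$, and let $G$ be an algebraic torus acting diagonally on $Y$. Assume that $G$ acts transitively on $W$, let $H$ be the stabilizer in $G$ of a point $w\in W$, and let $H^o$ be the connected component of the identity in $H$. The following conditions are equivalent. 1. $V^{H^o}=0$. 2. $\mathcal{D}(V)^{H^o}$ has enough simple finite dimensional modules. 3. $\mathcal{D}(Y)^G$ has a nonzero finite dimensional module. 4. $\mathcal{D}(Y)^G$ has enough simple finite dimensional modules.
   Context: $k$ is an algebraically closed field of characteristic $0$. $n=r+s$, $V=k^r$, $W=(k^\times)^s$, $Y=V\times W\subseteq k^n$. A diagonal action of a torus $G$ on $Y$ is one that extends to a diagonal action on $k^n$; it is given by an embedding of $G$ into the group $T\cong(k^\times)^n$ of diagonal matrices in $GL(n)$ (so the action is faithful). In particular $G$ preserves the factors $V$ and $W$ and so acts on each; $H\subseteq G$ acts on $V$ by restriction. $\mathcal{D}(Z)$ denotes the ring of differential operators on a variety $Z$; explicitly $\mathcal{D}(Y)=k[Q_1,\ldots,Q_r,Q_{r+1}^{\pm1},\ldots,Q_n^{\pm1},P_1,\ldots,P_n]$ and $\mathcal{D}(V)=k[Q_1,\ldots,Q_r,P_1,\ldots,P_r]$, where $Q_i$ are the coordinate functions and $P_i=\partial/\partial Q_i$. If $G$ acts on the $i$-th coordinate by the character $\eta_i$, then $g\cdot Q_i=\eta_i(g)Q_i$ and $g\cdot P_i=\eta_i(g)^{-1}P_i$; superscripts denote invariants. A $k$-algebra $R$ has enough simple finite dimensional modules if $\bigcap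 \mathrm{ann}_R M=0$, where the intersection is over all simple finite dimensional $R$-modules $M$. *)

(* Defs.v *)
From HB Require Import structures.
From mathcomp Require Import all_boot all_order all_algebra.
From mathcomp Require Import mathcomp_extra boolp classical_sets topology.
From mathcomp Require Import freeg mpoly.

Set Implicit Arguments.
Unset Strict Implicit.
Unset Printing Implicit Defensive.

Import Order.TTheory GRing.Theory Num.Theory.

Local Open Scope classical_set_scope.
Local Open Scope ring_scope.

Section Modules.
Variables (k : fieldType) (R : algType k).

Definition nonzero_mod (M : lmodType R) : Prop := exists u : M, u != 0.

(* Finite dimension is over k, which acts on M through a |-> a%:A. *)
Definition fin_dim (M : lmodType R) : Prop :=
  exists (d : nat) (b : 'I_d -> M), forall u : M,
    exists c : 'I_d -> k, u = \sum_(i < d) (c i)%:A *: b i.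

Definition simple_mod (M : lmodType R) : Prop :=
  nonzero_mod M /\
  forall N : {pred M}, submod_closed N -> N =i pred1 0 \/ N =i predT.

Definition enough_simple_fin_dim : Prop :=
  forall x : R,
    (forall M : lmodType R, simple_mod M -> fin_dim M ->
       forall u : M, x *: u = 0) ->
    x = 0.

End Modules.

(* The Zariski topology on k^m; its closed sets are the common zero loci of
   families of polynomials.  The alias keeps it apart from other topologies
   on 'rV[k]_m. *)
Definition zariski (k : fieldType) (m : nat) : Type := 'rV[k]_m.

HB.instance Definition _ (k : fieldType) (m : nat) :=
  Choice.on (zariski k m).

Section Zariski.
Variables (k : fieldType) (m : nat).

Definition zeros (S : set {mpoly k[m]}) : set (zariski k m) :=
  [set x : 'rV[k]_m | forall p, S p -> p.@[x ord0] = 0].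

Definition zariski_open (U : set (zariski k m)) : Prop :=
  exists S, U = ~` zeros S.

Lemma zariski_openP (U : set (zariski k m)) : zariski_open U <->
  exists S : set {mpoly k[m]},
    forall x : 'rV[k]_m, U x <-> exists2 p, S p & p.@[x ord0] != 0.
Proof.
have key S (x : 'rV[k]_m) :
    (~` zeros S) x <-> exists2 p, S p & p.@[x ord0] != 0.
  split=> [nz|[p Sp /eqP px] /(_ p Sp)//].
  apply: contrapT => nex; apply: nz => p Sp; apply/eqP.
  by apply: contrapT => /negP px; apply: nex; exists p.
split=> [[S ->]|[S US]]; exists S; first exact: key.
by apply/seteqP; split=> x; rewrite (propext (US x)) (propext (key S x)).
Qed.

Lemma zariski_openT : zariski_open setT.
Proof.
apply/zariski_openP; exists setT => x; split=> // _.
by exists 1 => //; rewrite meval1 oner_eq0.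
Qed.

Lemma zariski_openI : setI_closed zariski_open.
Proof.
move=> A B /zariski_openP[S AS] /zariski_openP[T BT].
apply/zariski_openP.
exists [set p | exists q r, [/\ S q, T r & p = q * r]] => x.
split=> [[/AS[q Sq qx] /BT[r Tr rx]]|[_ [q [r [Sq Tr ->]]]]].
  by exists (q * r); [exists q, r|rewrite mevalM mulf_neq0].
rewrite mevalM mulf_eq0 negb_or => /andP[qx rx].
by split; [apply/AS; exists q|apply/BT; exists r].
Qed.

Lemma zariski_open_bigU (I : Type) (f : I -> set (zariski k m)) :
  (forall i, zariski_open (f i)) -> zariski_open (\bigcup_i f i).
Proof.
move=> fo; have /choice[S fS] i := (zariski_openP (f i)).1 (fo i).
apply/zariski_openP; exists (\bigcup_i S i) => x; split.
  by move=> [i _ /fS[p Sp px]]; exists p => //; exists i.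
by move=> [p [i _ Sp] px]; exists i => //; apply/fS; exists p.
Qed.

HB.instance Definition _ := isOpenTopological.Build (zariski k m)
  zariski_openT zariski_openI zariski_open_bigU.

End Zariski.

Section Tori.
Variable k : fieldType.

Definition Gm (m : nat) : set 'rV[k]_m := [set t | forall i, t ord0 i != 0].
Arguments Gm : clear implicits.

Definition Gm1 (m : nat) : 'rV[k]_m := const_mx 1.

(* A row c stands for the diagonal matrix with diagonal c, so this is both
   the group law of Gm n and the diagonal action of Gm n on k^n. *)
Definition dact (n : nat) (c v : 'rV[k]_n) : 'rV[k]_n :=
  map2_mx *%R c v.

(* Regular functions on the principal open subset Gm m of k^m. *)
Definition regular_Gm (m : nat) (f : 'rV[k]_m -> k) : Prop :=
  exists (p : {mpoly k[m]}) (e : nat), forall t, Gm m t ->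
    f t = p.@[t ord0] / (\prod_i t ord0 i) ^+ e.

(* phi is an embedding of algebraic groups Gm m -> Gm n, i.e. a
   homomorphism that is a closed immersion of affine varieties: the comorphism
   f |-> f \o phi of coordinate rings is surjective.  The character by which
   the torus acts on the i-th coordinate is g |-> phi g ord0 i. *)
Definition torus_embedding (m n : nat) (phi : 'rV[k]_m -> 'rV[k]_n) : Prop :=
  [/\ forall i, regular_Gm (fun g => phi g ord0 i),
      forall g, Gm m g -> Gm n (phi g),
      forall g h, Gm m g -> Gm m h -> phi (dact g h) = dact (phi g) (phi h)
    & forall f, regular_Gm f ->
        exists2 F, regular_Gm F & forall g, Gm m g -> f g = F (phi g)].

Definition transitive_on (m s : nat) (psi : 'rV[k]_m -> 'rV[k]_s) : Prop :=
  forall w w', Gm s w -> Gm s w' -> exists2 g, Gm m g & dact (psi g) w = w'.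

Definition stabilizer (m s : nat) (psi : 'rV[k]_m -> 'rV[k]_s)
    (w : 'rV[k]_s) : set 'rV[k]_m :=
  [set g | Gm m g /\ dact (psi g) w = w].

(* The connected component of the identity, in the Zariski topology. *)
Definition id_component (m : nat) (H : set 'rV[k]_m) : set 'rV[k]_m :=
  @connected_component (zariski k m) H (Gm1 m).

Definition fixed_points (n : nat) (C : set 'rV[k]_n) : set 'rV[k]_n :=
  [set v | forall c, C c -> dact c v = v].

End Tori.

Arguments Gm : clear implicits.
Arguments Gm1 : clear implicits.

Lemma fglift_scalable (k : fieldType) (K : choiceType) (M : lmodType k)
  (F : K -> M) : scalable (fglift F : {freeg K / k} -> M).
Proof.
pose lf : {additive {freeg K / k} -> M} :=
  HB.pack (fglift F) (GRing.isAdditive.Build _ _ _ (lift_is_additive F)).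
move=> b f; rewrite -[fglift F]/(lf : _ -> _) -{2}(freeg_sumE f).
rewrite -[b *: f]/(\sum_(a <- dom f) << b * coeff a f *g a >>).
rewrite !raddf_sum; apply: eq_bigr => a _.
by rewrite /= !liftU scalerA.
Qed.

(* The coordinates in L are inverted: the variety Y_L of the points of k^n
   whose L-coordinates are nonzero has coordinate ring
   k[x_i, x_j^-1 | i < n, j in L], with k-basis the monomials x^a, a : expo L. *)
Section Exponents.
Variables (n : nat) (L : {set 'I_n}).

Definition is_expo (a : 'rV[int]_n) : bool :=
  [forall i, (i \in L) || (0 <= a ord0 i)].

Definition expo : Type := {a : 'rV[int]_n | is_expo a}.

HB.instance Definition _ := Choice.on expo.

Fact is_expo0 : is_expo 0.
Proof. by apply/forallP => i; rewrite mxE lexx orbT. Qed.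

Definition expo0 : expo := Sub 0 is_expo0.

(* Only used when a + d is an exponent, or with a zero coefficient. *)
Definition expo_shift (d : 'rV[int]_n) (a : expo) : expo :=
  insubd expo0 (val a + d).

End Exponents.

Arguments expo_shift {n L} d a.

Notation coord_ring k L := {freeg (expo L) / k}.

Section Endomorphisms.
Variables (k : fieldType) (n : nat) (L : {set 'I_n}).
Local Notation O := (coord_ring k L).

Definition endo : Type := {linear O -> O}.

HB.instance Definition _ := gen_eqMixin endo.
HB.instance Definition _ := gen_choiceMixin endo.

Implicit Types f g h : endo.

Lemma endoP f g : (forall x, f x = g x) -> f = g.
Proof.
case: f g => [f [[fA] [fZ]]] [g [[gA] [gZ]]] /= fg.
have E : f = g by apply/funext.
rewrite -E in gA gZ *.
by rewrite (Prop_irrelevance fA gA) (Prop_irrelevance fZ gZ).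
Qed.

Let add f g : endo := f \+ g.
Let opp f : endo := \- f.
Let zero : endo := \0.
Let scale (a : k) f : endo := a \*: f.
Let one : endo := idfun.
Let mul f g : endo := f \o g.

Fact endo_addA : associative add.
Proof. by move=> f g h; apply: endoP => x /=; rewrite addrA. Qed.
Fact endo_addC : commutative add.
Proof. by move=> f g; apply: endoP => x /=; rewrite addrC. Qed.
Fact endo_add0 : left_id zero add.
Proof. by move=> f; apply: endoP => x /=; rewrite add0r. Qed.
Fact endo_addN : left_inverse zero opp add.
Proof. by move=> f; apply: endoP => x /=; rewrite addNr. Qed.

HB.instance Definition _ :=
  GRing.isZmodule.Build endo endo_addA endo_addC endo_add0 endo_addN.

Fact endo_mulA : associative mul.
Proof. by move=> f g h; apply: endoP. Qed.
Fact endo_mul1l : left_id one mul.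
Proof. by move=> f; apply: endoP. Qed.
Fact endo_mul1r : right_id one mul.
Proof. by move=> f; apply: endoP. Qed.
Fact endo_mulDl : left_distributive mul +%R.
Proof. by move=> f g h; apply: endoP. Qed.
Fact endo_mulDr : right_distributive mul +%R.
Proof. by move=> f g h; apply: endoP => x /=; rewrite raddfD. Qed.
Fact endo_one_neq0 : one != 0.
Proof.
apply/eqP => /(congr1 (fun f : endo => f << expo0 L >>)) /= /eqP.
by rewrite freegU_eq0 oner_eq0.
Qed.

HB.instance Definition _ := GRing.Zmodule_isNzRing.Build endo
  endo_mulA endo_mul1l endo_mul1r endo_mulDl endo_mulDr endo_one_neq0.

Fact endo_scaleA a b f : scale a (scale b f) = scale (a * b) f.
Proof. by apply: endoP => x /=; rewrite scalerA. Qed.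
Fact endo_scale1 : left_id 1 scale.
Proof. by move=> f; apply: endoP => x /=; rewrite scale1r. Qed.
Fact endo_scaleDr : right_distributive scale +%R.
Proof. by move=> a f g; apply: endoP => x /=; rewrite scalerDr. Qed.
Fact endo_scaleDl f : {morph scale^~ f : a b / a + b}.
Proof. by move=> a b; apply: endoP => x /=; rewrite scalerDl. Qed.

HB.instance Definition _ := GRing.Zmodule_isLmodule.Build k endo
  endo_scaleA endo_scale1 endo_scaleDr endo_scaleDl.

Fact endo_scaleAl (a : k) f g : a *: (f * g) = (a *: f) * g.
Proof. exact: endoP. Qed.

HB.instance Definition _ :=
  GRing.Lmodule_isLalgebra.Build k endo endo_scaleAl.

Fact endo_scaleAr (a : k) f g : a *: (f * g) = f * (a *: g).
Proof. by apply: endoP => x /=; rewrite linearZ. Qed.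

HB.instance Definition _ :=
  GRing.Lalgebra_isAlgebra.Build k endo endo_scaleAr.

End Endomorphisms.

Lemma endoM (k : fieldType) (n : nat) (L : {set 'I_n}) (f g : endo k L)
  (x : coord_ring k L) : (f * g) x = f (g x).
Proof. by []. Qed.

Section DifferentialOperators.
Variables (k : fieldType) (n : nat) (L : {set 'I_n}).
Local Notation O := (coord_ring k L).
Local Notation E := (endo k L).

(* The k-linear map x^a |-> c a * x^(s a). *)
Definition mono_fun (c : expo L -> k) (s : expo L -> expo L) : O -> O :=
  fglift (fun a => c a *: << s a >> : O).

Fact mono_fun_additive c s : additive (mono_fun c s).
Proof. exact: lift_is_additive. Qed.

HB.instance Definition _ c s :=
  GRing.isAdditive.Build O O (mono_fun c s) (mono_fun_additive c s).

Fact mono_fun_scalable c s : scalable (mono_fun c s).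
Proof. exact: fglift_scalable. Qed.

HB.instance Definition _ c s :=
  GRing.isScalable.Build k O O *:%R (mono_fun c s) (mono_fun_scalable c s).

Definition mono_op (c : expo L -> k) (s : expo L -> expo L) : E := mono_fun c s.

Lemma mono_opE c s a : mono_op c s << a >> = c a *: << s a >>.
Proof. by rewrite /mono_op /= /mono_fun liftU scale1r. Qed.

Lemma mono_opZ c s b a : mono_op c s (b *: << a >>) = (b * c a) *: << s a >>.
Proof. by rewrite linearZZ mono_opE scalerA. Qed.

Local Notation ei i := (delta_mx ord0 i : 'rV[int]_n).

Definition Qop (i : 'I_n) : E := mono_op (fun=> 1) (expo_shift (ei i)).
Definition Qinv_op (i : 'I_n) : E := mono_op (fun=> 1) (expo_shift (- ei i)).
(* d/dx_i; when i is not in L and a_i = 0 the shifted exponent is junk, but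
   its coefficient is 0. *)
Definition Pop (i : 'I_n) : E :=
  mono_op (fun a => (val a ord0 i)%:~R) (expo_shift (- ei i)).

(* D(Y_L) is the k-subalgebra of End_k(O) generated by the coordinates, the
   inverses of those in L, and the partial derivatives; in characteristic 0
   these are all the differential operators. *)
Definition is_diffop (x : E) : Prop :=
  forall S : {pred E}, GRing.subalg_closed S ->
    (forall i, Qop i \in S) -> (forall i, i \in L -> Qinv_op i \in S) ->
    (forall i, Pop i \in S) -> x \in S.

(* The diagonal matrix c acts on O by x_i |-> c_i * x_i, hence on operators
   by conjugation; see diag_conj_Qop and diag_conj_Pop. *)
Definition diag_op (c : 'rV[k]_n) : E :=
  mono_op (fun a => \prod_i c ord0 i ^ val a ord0 i) id.

Definition diag_conj (c : 'rV[k]_n) (x : E) : E :=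
  diag_op c * x * diag_op (map_mx GRing.inv c).

Lemma endo_eqP (x y : E) : (forall a, x << a >> = y << a >>) -> x = y.
Proof.
move=> xy; apply: endoP => f; rewrite -(freeg_sumE f) !raddf_sum.
apply: eq_bigr => a _; set b := coeff a f.
have -> : << b *g a >> = b *: (<< a >> : O).
  by apply/eqP/freeg_eqP => a'; rewrite coeffZ !coeffU mul1r.
by rewrite /= !linearZZ xy.
Qed.

Lemma diag_op1 : diag_op (Gm1 k n) = 1.
Proof.
apply: endo_eqP => a; rewrite mono_opE big1 ?scale1r // => i _.
by rewrite mxE exp1rz.
Qed.

Lemma diag_opM c d : diag_op c * diag_op d = diag_op (dact c d).
Proof.
apply: endo_eqP => a; rewrite endoM !mono_opE linearZZ mono_opE scalerA.
rewrite -big_split; congr (_ *: _); apply: eq_bigr => i _.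
by rewrite mxE expfzMl mulrC.
Qed.

Lemma diag_opK c : Gm k n c -> diag_op c * diag_op (map_mx GRing.inv c) = 1.
Proof.
move=> c0; rewrite diag_opM -diag_op1; congr diag_op.
by apply/rowP => i; rewrite !mxE mulfV.
Qed.

Lemma diag_opVK c : Gm k n c -> diag_op (map_mx GRing.inv c) * diag_op c = 1.
Proof.
move=> c0; rewrite diag_opM -diag_op1; congr diag_op.
by apply/rowP => i; rewrite !mxE mulVf.
Qed.

Lemma diag_conjM c x y : Gm k n c ->
  diag_conj c (x * y) = diag_conj c x * diag_conj c y.
Proof.
move=> c0; rewrite /diag_conj !mulrA -[_ * _ * diag_op c]mulrA.
by rewrite diag_opVK // mulr1.
Qed.

Lemma diag_conj_mono c (b : expo L -> k) (d : 'rV[int]_n) (i : 'I_n) (e : int) :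
  Gm k n c -> d = e *: ei i ->
  (forall a, b a != 0 -> is_expo L (val a + d)) ->
  diag_conj c (mono_op b (expo_shift d)) =
  c ord0 i ^ e *: mono_op b (expo_shift d).
Proof.
move=> c0 -> bd; apply: endo_eqP => a; rewrite /diag_conj !endoM.
rewrite -[RHS]/(c ord0 i ^ e *: mono_op b (expo_shift (e *: ei i)) << a >>).
rewrite !mono_opE !mono_opZ scalerA.
have [->|/bd Pa] := eqVneq (b a) 0; first by rewrite !(mulr0, mul0r) !scale0r.
congr (_ *: _); rewrite mulrAC; congr (_ * _).
rewrite -big_split (bigD1 i) //= big1 ?mulr1 => [|j /negPf ji].
  rewrite insubdK // !mxE !eqxx mulr1 exprz_inv -expfzDr; last exact: c0.
  by rewrite addKr.
rewrite insubdK // !mxE ji andbF mulr0 addr0 exprz_inv -expfzDr; last exact: c0.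
by rewrite addNr.
Qed.

Lemma diag_conj_Qop c i : Gm k n c -> diag_conj c (Qop i) = c ord0 i *: Qop i.
Proof.
move=> c0; rewrite -[in RHS](expr1z (c ord0 i)).
apply: diag_conj_mono => // [|a _]; first by rewrite scale1r.
apply/forallP => j; rewrite !mxE; have /forallP/(_ j) := valP a.
by case: (j \in L) => //= aj; rewrite addr_ge0 // ler0n.
Qed.

Lemma diag_conj_Pop c i :
  Gm k n c -> diag_conj c (Pop i) = (c ord0 i)^-1 *: Pop i.
Proof.
move=> c0; rewrite -[(c ord0 i)^-1]/(c ord0 i ^ (-1)).
apply: diag_conj_mono => // [|a a0]; first by rewrite scaleN1r.
apply/forallP => j; rewrite !mxE eqxx; have /forallP/(_ j) := valP a.
case: (j \in L) => //=; have [->|_] := eqVneq j i; last by rewrite subr0.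
have : val a ord0 i != 0 by apply: contraNneq a0 => ->.
by case: (val a ord0 i) => [[|p]|p] // _ _; rewrite -subn1 // -subzn.
Qed.

(* Invariants of the action of C `&` Gm on the ring of differential operators;
   C will always be contained in Gm. *)
Definition inv_diffop (C : set 'rV[k]_n) : {pred E} :=
  [pred x : E | `[< is_diffop x /\
                   forall c, C c -> Gm k n c -> diag_conj c x = x >]].

Fact inv_diffop_closed C : GRing.subalg_closed (inv_diffop C).
Proof.
split.
- apply/asboolP; split=> [S [] //|c _ c0].
  by rewrite /diag_conj mulr1 diag_opK.
- move=> b x y /asboolP[Dx Cx] /asboolP[Dy Cy]; apply/asboolP; split.
    move=> S algS SQ SQ' SP; case: (algS) => _ linS _.
    by apply: linS; [apply: Dx|apply: Dy].
  move=> c Cc c0; rewrite -{2}(Cx c Cc c0) -{2}(Cy c Cc c0) /diag_conj.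
  by rewrite mulrDr mulrDl -scalerAr -scalerAl.
- move=> x y /asboolP[Dx Cx] /asboolP[Dy Cy]; apply/asboolP; split.
    move=> S algS SQ SQ' SP; case: (algS) => _ _ mulS.
    by apply: mulS; [apply: Dx|apply: Dy].
  by move=> c Cc c0; rewrite diag_conjM // Cx // Cy.
Qed.

HB.instance Definition _ C :=
  GRing.isSubalgClosed.Build k E (inv_diffop C) (inv_diffop_closed C).

Definition inv_diffops (C : set 'rV[k]_n) : Type := {x : E | inv_diffop C x}.

HB.instance Definition _ C := SubChoice.on (inv_diffops C).
HB.instance Definition _ C := [SubChoice_isSubAlgebra of inv_diffops C by <:].

End DifferentialOperators.

Definition inverted (r s : nat) : {set 'I_(r + s)} :=
  finset (fun i : 'I_(r + s) => (r <= i)%N).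

(* The coordinate rings of k^r * Gm s and of k^r, respectively, are those with
   the last s coordinates inverted and with no coordinate inverted. *)
Definition DY_inv (k : fieldType) (r s : nat) (C : set 'rV[k]_(r + s)) :
    algType k :=
  inv_diffops (inverted r s) C.

Definition DV_inv (k : fieldType) (r : nat) (C : set 'rV[k]_r) : algType k :=
  inv_diffops finset.set0 C.

(* Main.v *)
Require Import Defs.
From HB Require Import structures.
From mathcomp Require Import all_boot all_order all_algebra.
From mathcomp Require Import mathcomp_extra boolp classical_sets topology.
From mathcomp Require Import cardinality.
From mathcomp Require Import freeg mpoly zify.

Set Implicit Arguments.
Unset Strict Implicit.
Unset Printing Implicit Defensive.

Import Order.TTheory GRing.Theory Num.Theory.

Local Open Scope classical_set_scope.
Local Open Scope ring_scope.

(* Let phi act on the i-th coordinate by the character g |-> g^(A_i).  If no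
   A_i (i < r) has a positive multiple in the Z-span of the A_(r+j), then some
   one-parameter subgroup mu of H^o pairs nontrivially with all A_i, i < r.
   Hence V^(H^o) = 0.  Moreover each weight vector of the box given by
   a_i >= 0 when <mu, A_i> > 0 and a_i < 0 when <mu, A_i> < 0 generates a
   finite dimensional simple module over the invariants: the weights of the
   module lie in the box and in a coset of the lattice of invariant weights,
   on which sum_i <mu, A_i> a_i is constant.  An operator x acts on these
   modules through its symbol: x maps x^a to the sum over d of
   F_d(a) x^(a + d) with F_d polynomial, so an operator that annihilates all of
   them vanishes.
   If N A_i = sum_j c_j A_(r+j) with N > 0, then A_i has finite order on H, so
   it is trivial on H^o and V^(H^o) contains the i-th axis.  Also
   Q_i^N Q_W^(-c) and P_i^N Q_W^c are invariant, and together with Q_i P_i they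
   exclude nonzero finite dimensional modules, because a raising operator
   dies only at negative eigenvalues of Q_i P_i and a lowering operator only
   at nonnegative ones.  The same argument with Q_i and P_i applies to
   D(V)^(H^o). *)

(** * Eigenvalues on finite dimensional modules *)

Section CharZero.
Variables (k : fieldType) (k_char0 : [pchar k] =i pred0).

Lemma pchar0_natr_eq0 n : (n%:R == 0 :> k) = (n == 0)%N.
Proof. by move/pcharf0P: k_char0 => ->. Qed.

Lemma pchar0_intr_eq0 (z : int) : (z%:~R == 0 :> k) = (z == 0).
Proof.
by case: z => n; rewrite ?NegzE ?rmorphN ?oppr_eq0 /= -?pmulrn pchar0_natr_eq0.
Qed.

Lemma pchar0_intr_inj : injective (fun z : int => z%:~R : k).
Proof.
by move=> y z /eqP; rewrite -subr_eq0 -rmorphB pchar0_intr_eq0 subr_eq0 => /eqP.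
Qed.

(** In characteristic 0 the progression [a + b *+ t] never repeats a value, so [size q] of its terms
    cannot all be roots of [q]. *)
Lemma poly_natr_nonroot (q : {poly k}) (a b : k) (T : nat) :
  q != 0 -> b != 0 -> exists2 t, (T <= t)%N & q.[a + b *+ t] != 0.
Proof.
move=> q0 b0; apply: contrapT => nex.
pose s := [seq a + b *+ (T + t) | t <- iota 0 (size q)].
suff: (size s < size q)%N by rewrite size_map size_iota ltnn.
apply: max_poly_roots => //.
  apply/allP => _ /mapP[t _ ->]; apply/rootP; apply: contrapT => qt.
  by apply: nex; exists (T + t)%N; [rewrite leq_addr|apply/eqP].
rewrite map_inj_uniq ?iota_uniq // => u v /addrI /eqP.
have bE c : b *+ c = b * c%:~R by rewrite -mulr_natr pmulrn.
by rewrite !bE => /eqP/(mulfI b0)/pchar0_intr_inj[] /addnI.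
Qed.

End CharZero.

Section FiniteDimensionalModules.
Variables (k : closedFieldType) (k_char0 : [pchar k] =i pred0).
Variables (R : algType k) (M : lmodType R).
Hypothesis M_fin : fin_dim M.
Hypothesis M_nz : nonzero_mod M.

Lemma scalerCA (x : R) (c : k) (u : M) : x *: (c%:A *: u) = c%:A *: (x *: u).
Proof. by rewrite !scalerA mulr_algl mulr_algr. Qed.

Lemma scaler_alg_eq0 (c : k) (u : M) :
  c != 0 -> c%:A *: u = 0 -> u = 0.
Proof.
move=> c0 /(congr1 (fun v => c^-1%:A *: v)).
by rewrite scaler0 scalerA mulr_algl [_^-1 *: _]scalerA mulVf // !scale1r.
Qed.

(** Cayley-Hamilton for a matrix [A] of the action of [x] on the family [b]. That family only spans,
    but p(x) b_i = sum_j p(A)_ij b_j holds for any choice of [A]. *)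
Lemma horner_alg_annihilates (x : R) :
  exists2 p, p != 0 & forall u : M, horner_alg x p *: u = 0.
Proof.
have [[|d] [b bP]] := M_fin.
  have [u u0] := M_nz; have [c uE] := bP u.
  by move: u0; rewrite uE big_ord0 eqxx.
have [A AP] : exists A : 'M[k]_d.+1,
    forall i, x *: b i = \sum_j (A i j)%:A *: b j.
  have [f fP] := choice (fun i => bP (x *: b i)).
  exists (\matrix_(i, j) f i j) => i; rewrite fP.
  by under [RHS]eq_bigr do rewrite mxE.
exists (char_poly A); first exact/monic_neq0/char_poly_monic.
have main p i : horner_alg x p *: b i = \sum_j (horner_mx A p i j)%:A *: b j.
  elim/poly_ind: p i => [|p c IH] i.
    rewrite !rmorph0 scale0r big1 // => j _.
    by rewrite mxE scale0r scale0r.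
  rewrite !rmorphD !rmorphM /= horner_algX horner_algC horner_mx_X horner_mx_C.
  rewrite scalerDl -scalerA AP scaler_sumr.
  have E j : horner_alg x p *: ((A i j)%:A *: b j) =
      \sum_l ((A i j) * horner_mx A p j l)%:A *: b l.
    rewrite scalerCA IH scaler_sumr; apply: eq_bigr => l _.
    by rewrite scalerA mulr_algl scalerA.
  rewrite (eq_bigr _ (fun j _ => E j)) exchange_big /=.
  under [RHS]eq_bigr => j _ do rewrite mxE scalerDl scalerDl.
  rewrite [RHS]big_split /=; congr (_ + _); last first.
    rewrite (bigD1 i) //= mxE eqxx mulr1n big1 ?addr0 // => j ji.
    by rewrite mxE eq_sym (negPf ji) mulr0n scale0r scale0r.
  apply: eq_bigr => j _.
  have -> : horner_mx A p * A = A *m horner_mx A p by exact: comm_horner_mx.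
  by rewrite mxE -!scaler_suml.
move=> u; have [c ->] := bP u.
rewrite scaler_sumr big1 // => i _; rewrite scalerCA main Cayley_Hamilton.
by rewrite big1 ?scaler0 // => j _; rewrite mxE !scale0r.
Qed.

Lemma horner_alg_eigen (x : R) (c : k) (v : M) p :
  x *: v = c%:A *: v -> horner_alg x p *: v = (p.[c])%:A *: v.
Proof.
move=> xv; elim/poly_ind: p => [|p a IH].
  by rewrite !rmorph0 horner0 !scale0r.
rewrite rmorphD rmorphM /= horner_algX horner_algC scalerDl -scalerA xv.
rewrite scalerCA IH scalerA mulr_algl !hornerE mulrC.
by rewrite scalerDl scalerDl scalerA.
Qed.

(** An annihilating polynomial splits into linear factors. When these are applied one by one to a
    nonzero vector, the first that yields zero was applied to an eigenvector. *)
Lemma eigenvector_exists (x : R) :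
  exists v : M, v != 0 /\ exists c : k, x *: v = c%:A *: v.
Proof.
have [p p0 pM] := horner_alg_annihilates x.
have [u u0] := M_nz.
have [rs rsE] := closed_field_poly_normal p.
have : horner_alg x (\prod_(z <- rs) ('X - z%:P)) *: u = 0.
  have p1 : lead_coef p != 0 by rewrite lead_coef_eq0.
  apply: (scaler_alg_eq0 p1); rewrite scalerA.
  by have := pM u; rewrite {1}rsE linearZ.
elim: rs u u0 {rsE} => [|c rs IH] u u0.
  by rewrite big_nil rmorph1 scale1r => /eqP; rewrite (negPf u0).
rewrite big_cons mulrC rmorphM -scalerA /=.
have [xu0|xu0] := eqVneq (horner_alg x ('X - c%:P) *: u) 0; last exact: IH.
move=> _; exists u; split=> //; exists c.
apply/eqP; rewrite -subr_eq0 -scalerBl.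
by move: xu0; rewrite rmorphB /= horner_algX horner_algC => ->.
Qed.

(* [a] shifts the eigenvalues of [x] by [e], and there are only finitely many
   of them. *)
Lemma shift_eigenvector (x a : R) (e c : k) (v : M) :
  e != 0 -> x * a = a * (x + e%:A) -> v != 0 -> x *: v = c%:A *: v ->
  exists2 u : M, u != 0 & exists j : nat, x *: u = (c + e *+ j)%:A *: u /\
    a *: u = 0.
Proof.
move=> e0 xa v0 xv; have [p p0 pM] := horner_alg_annihilates x.
pose w j := a ^+ j *: v.
have xw j : x *: w j = (c + e *+ j)%:A *: w j.
  elim: j => [|j IH]; first by rewrite /w expr0 scale1r mulr0n addr0.
  rewrite /w exprS -scalerA -/(w j) scalerA xa -scalerA scalerDl IH -scalerDl.
  by rewrite -scalerDl scalerCA -addrA mulrSr.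
have w0 : ~ forall j, w j != 0.
  move=> w0; have [t _] := poly_natr_nonroot k_char0 c 0 p0 e0.
  case/negP; apply/eqP; have := horner_alg_eigen p (xw t); rewrite pM.
  move/esym => zw; apply: contrapT => /eqP z0.
  by have /eqP := scaler_alg_eq0 z0 zw; rewrite (negPf (w0 t)).
have ex0 : exists j, w j == 0.
  apply: contrapT => nex; apply: w0 => j; apply/negP => wj.
  by apply: nex; exists j.
have [m wm min] := ex_minnP ex0.
case: m wm min => [|m] wm min.
  by move: wm; rewrite /w scale1r (negPf v0).
exists (w m); first by apply/negP => /min; rewrite ltnn.
by exists m; split; [exact: xw|rewrite /w scalerA -exprS; apply/eqP].
Qed.

End FiniteDimensionalModules.

(* With [x = Q d/dQ], [a = Q^N] and [b = (d/dQ)^N]: the last eigenvalue of [x]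
   along the orbit of an eigenvector under [a] is a negative integer, while
   the last one under [b] is a nonnegative integer. *)
Lemma no_fin_dim_module (k : closedFieldType) (k_char0 : [pchar k] =i pred0)
    (R : algType k) (x a b : R) (N : nat) :
  (0 < N)%N ->
  x * a = a * (x + (N%:R : k)%:A) -> x * b = b * (x + (- N%:R : k)%:A) ->
  b * a = \prod_(l < N) (x + (l.+1%:R : k)%:A) ->
  a * b = \prod_(l < N) (x - (l%:R : k)%:A) ->
  forall M : lmodType R, fin_dim M -> ~ nonzero_mod M.
Proof.
move=> N0 xa xb ba ab M Mfin Mnz.
have prodE (f : 'I_N -> k) c (u : M) : u != 0 -> x *: u = c%:A *: u ->
    (\prod_(l < N) (x + (f l)%:A)) *: u = 0 -> exists l, c + f l = 0.
  move=> u0 xu.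
  have -> : \prod_(l < N) (x + (f l)%:A) =
      horner_alg x (\prod_(l < N) ('X + (f l)%:P)).
    rewrite rmorph_prod; apply: eq_bigr => l _.
    by rewrite rmorphD /= horner_algX horner_algC.
  rewrite (horner_alg_eigen _ xu) horner_prod => p0.
  have /eqP/prodf_eq0[l _] : \prod_(l < N) ('X + (f l)%:P).[c] = 0.
    by apply: contrapT => /eqP /scaler_alg_eq0 /(_ p0) /eqP; rewrite (negPf u0).
  by rewrite hornerD hornerX hornerC => /eqP; exists l.
have [v [v0 [c xv]]] := eigenvector_exists Mfin Mnz x.
have N1 : N%:R != 0 :> k by rewrite pchar0_natr_eq0 // -lt0n.
have [u u0 [i [xu au]]] := shift_eigenvector k_char0 Mfin Mnz N1 xa v0 xv.
have N2 : - N%:R != 0 :> k by rewrite oppr_eq0.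
have [t t0 [j [xt bt]]] := shift_eigenvector k_char0 Mfin Mnz N2 xb v0 xv.
have [l cl] : exists l : 'I_N, c + N%:R *+ i + l.+1%:R = 0.
  by apply: (prodE _ _ _ u0 xu); rewrite -ba -scalerA au scaler0.
have [l' cl'] : exists l : 'I_N, c + (- N%:R) *+ j - l%:R = 0.
  apply: (prodE _ _ _ t0 xt); under eq_bigr => l' _ do rewrite scaleNr.
  by rewrite -ab -scalerA bt scaler0.
have cE : c = N%:R *+ j + l'%:R.
  by move/eqP: cl'; rewrite mulNrn subr_eq0 subr_eq addrC => /eqP.
(* Both values of [c] together express 0 as a sum of natural numbers containing [l.+1], impossible
   in characteristic 0. *)
move/eqP: cl; rewrite cE -!mulrnA -!natrD pchar0_natr_eq0 //.
by rewrite addnS.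
Qed.

(** * Symbols of differential operators *)

Lemma eq_big_support (V : nmodType) (I : eqType) (s t : seq I) (F : I -> V) :
  uniq s -> uniq t -> (forall i, F i != 0 -> (i \in s) = (i \in t)) ->
  \sum_(i <- s) F i = \sum_(i <- t) F i.
Proof.
move=> us ut st.
have E (r : seq I) : \sum_(i <- r) F i =
    \sum_(i <- [seq i <- r | F i != 0]) F i.
  rewrite big_filter [LHS](bigID (fun i => F i != 0)) /= addrC big1 ?add0r //.
  by move=> i; rewrite negbK => /eqP.
rewrite E [RHS]E; apply: perm_big; apply: uniq_perm; rewrite ?filter_uniq //.
by move=> i; rewrite !mem_filter; case: eqVneq => //= /st.
Qed.

Section LinePolynomials.
Variables (k : fieldType) (k_char0 : [pchar k] =i pred0) (n : nat).
Implicit Types (g h : 'rV[int]_n -> k) (a s d : 'rV[int]_n).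

(* Polynomiality along every line is all that is used of the polynomial
   functions on Z^n. *)
Definition poly_on_lines g :=
  forall a s, exists q : {poly k}, forall t : nat, g (a + s *+ t) = q.[t%:R].

Lemma poly_on_lines_cst c : poly_on_lines (fun=> c).
Proof. by move=> a s; exists c%:P => t; rewrite hornerC. Qed.

Lemma poly_on_lines_coord i : poly_on_lines (fun a => (a ord0 i)%:~R).
Proof.
move=> a s; exists ((a ord0 i)%:~R%:P + (s ord0 i)%:~R%:P * 'X) => t.
by rewrite !hornerE mxE mulmxnE rmorphD /= rmorphMn /= mulr_natr.
Qed.

Lemma poly_on_linesD g h :
  poly_on_lines g -> poly_on_lines h -> poly_on_lines (fun a => g a + h a).
Proof.
move=> pg ph a s; have [p gp] := pg a s; have [q hq] := ph a s.
by exists (p + q) => t; rewrite hornerD gp hq.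
Qed.

Lemma poly_on_linesM g h :
  poly_on_lines g -> poly_on_lines h -> poly_on_lines (fun a => g a * h a).
Proof.
move=> pg ph a s; have [p gp] := pg a s; have [q hq] := ph a s.
by exists (p * q) => t; rewrite hornerM gp hq.
Qed.

Lemma poly_on_lines_sum (I : Type) (r : seq I) (G : I -> 'rV[int]_n -> k) :
  (forall i, poly_on_lines (G i)) ->
  poly_on_lines (fun a => \sum_(i <- r) G i a).
Proof.
move=> pG; elim: r => [|i r IH].
  have := poly_on_lines_cst 0.
  by congr poly_on_lines; apply/funext => a; rewrite big_nil.
have := poly_on_linesD (pG i) IH.
by congr poly_on_lines; apply/funext => a; rewrite big_cons.
Qed.

Lemma poly_on_lines_shift g d :
  poly_on_lines g -> poly_on_lines (fun a => g (a + d)).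
Proof.
by move=> pg a s; have [q gq] := pg (a + d) s; exists q => t; rewrite addrAC.
Qed.

(** Along the direction [s], [g] is a polynomial with all large integers as roots, hence zero; its
    value at [t = 0] is [g a]. *)
Lemma poly_on_lines_eq0 g s :
  poly_on_lines g ->
  (forall a, exists T, forall t, (T <= t)%N -> g (a + s *+ t) = 0) ->
  forall a, g a = 0.
Proof.
move=> pg g0 a; have [q gq] := pg a s; have [T gT] := g0 a.
have q0 : q = 0.
  apply/eqP; apply: contrapT => /negP q0.
  have [t Tt] := poly_natr_nonroot k_char0 0 T q0 (oner_neq0 k).
  by rewrite add0r -gq gT ?eqxx.
by have := gq 0%N; rewrite mulr0n addr0 q0 horner0.
Qed.

End LinePolynomials.

Section Symbols.
Variables (k : fieldType) (k_char0 : [pchar k] =i pred0).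
Variables (n : nat) (L : {set 'I_n}).
Local Notation E := (endo k L).
Local Notation Zn := 'rV[int]_n.
Implicit Types (x y : E) (F G : Zn -> Zn -> k) (a d : Zn) (u v : expo L).

(* [x] maps the monomial of exponent [a] to the sum over [d] of [F d a] times
   the monomial of exponent [a + d].  The third condition makes the same
   formula define an action on the span of any box of exponents obtained by
   imposing [0 <= a_i] or [a_i < 0] for each [i] not in [L]. *)
Definition is_symbol x F :=
  [/\ exists D : seq Zn, forall d a, F d a != 0 -> d \in D,
      forall d, poly_on_lines (F d),
      forall d a i, i \notin L -> 0 <= a ord0 i -> a ord0 i + d ord0 i < 0 ->
        F d a = 0
    & forall u v, coeff v (x << u >>) = F (val v - val u) (val u)].

Lemma coeff_endo x f v :
  coeff v (x f) = \sum_(u <- dom f) coeff u f * coeff v (x << u >>).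
Proof.
rewrite -{1}(freeg_sumE f) !raddf_sum; apply: eq_bigr => u _.
have -> : << coeff u f *g u >> = coeff u f *: (<< u >> : coord_ring k L).
  by apply/eqP/freeg_eqP => w; rewrite coeffZ !coeffU mul1r.
by rewrite /= linearZZ coeffZ.
Qed.

Lemma is_expoP a :
  reflect (forall i, i \notin L -> 0 <= a ord0 i) (is_expo L a).
Proof.
apply: (iffP forallP) => H i; first by have := H i; case: (i \in L).
by case: (boolP (i \in L)) => //= /H.
Qed.

Lemma symbol_expo x F u d :
  is_symbol x F -> F d (val u) != 0 -> is_expo L (val u + d).
Proof.
move=> [_ _ F0 _] Fd; apply/is_expoP => i iL; rewrite mxE leNgt.
apply/negP => lt0; case/negP: Fd; apply/eqP; apply: F0 lt0 => //.
by have /is_expoP := valP u; apply.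
Qed.

Lemma is_symbol_linear (c : k) x F y G :
  is_symbol x F -> is_symbol y G ->
  is_symbol (c *: x + y) (fun d a => c * F d a + G d a).
Proof.
move=> [[D FD] pF F0 xF] [[D' GD'] pG G0 yG]; split.
- exists (D ++ D') => d a; rewrite mem_cat.
  have [->|/FD->//] := eqVneq (F d a) 0.
  by rewrite mulr0 add0r => /GD' ->; rewrite orbT.
- move=> d; apply: poly_on_linesD => //; apply: poly_on_linesM => //.
  exact: poly_on_lines_cst.
- by move=> d a i iL a0 ad0; rewrite (F0 d a i) // (G0 d a i) // mulr0 addr0.
- by move=> u v; rewrite coeffD coeffZ xF yG.
Qed.

Lemma is_symbolM x F y G (D : seq Zn) :
  is_symbol x F -> is_symbol y G ->
  uniq D -> (forall d a, G d a != 0 -> d \in D) ->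
  is_symbol (x * y) (fun d a => \sum_(e <- D) F (d - e) (a + e) * G e a).
Proof.
move=> [[D' FD'] pF F0 xF] yGsym uD GD; have [_ pG G0 yG] := yGsym; split.
- exists [seq d + e | d <- D', e <- D] => d a Fd.
  have [e eD FG] : exists2 e, e \in D & F (d - e) (a + e) * G e a != 0.
    apply: contrapT => nex; case/negP: Fd; rewrite big_seq big1 // => e eD.
    by apply/eqP; apply: contrapT => /negP FG; apply: nex; exists e.
  apply/allpairsP; exists (d - e, e); split=> //=; last by rewrite subrK.
  by apply: (FD' _ (a + e)); apply: contraNneq FG => ->; rewrite mul0r.
- move=> d; apply: poly_on_lines_sum => e; apply: poly_on_linesM => //.
  exact: poly_on_lines_shift.
- move=> d a i iL a0 ad0; rewrite big1 // => e _.
  (* Either [y] already makes the coordinate negative, or [x] takes it from a nonnegative to a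
     negative value. *)
  have [ae0|ae0] := ltP (a ord0 i + e ord0 i) 0.
    by rewrite (G0 e a i) // mulr0.
  by rewrite (F0 _ _ i) ?mul0r // !mxE // -addrA subrKC.
- move=> u w; rewrite endoM coeff_endo.
  under eq_bigr => v _ do rewrite yG xF.
  pose H e := F (val w - val u - e) (val u + e) * G e (val u).
  transitivity (\sum_(e <- [seq val v - val u | v <- dom (y << u >>)]) H e).
    rewrite [RHS]big_map /=; apply: eq_bigr => v _; rewrite mulrC /H subrKC.
    by congr (F _ _ * _); rewrite opprB addrA subrK.
  apply: eq_big_support => //.
    rewrite map_inj_uniq ?uniq_dom // => v v' /addIr; exact: val_inj.
  move=> e; rewrite mulf_eq0 negb_or => /andP[_ Ge]; rewrite (GD _ _ Ge).
  have Pue := symbol_expo yGsym Ge.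
  apply/mapP; exists (Sub (val u + e) Pue : expo L).
    by rewrite mem_dom yG SubK addrC addKr.
  by rewrite SubK addrC addKr.
Qed.

(** Far out in the direction (1, ..., 1) both [a] and [a + d] are exponents, so [F d a] is a
    coefficient of the zero operator; polynomiality carries the vanishing back to every [a]. *)
Lemma is_symbol0_eq0 F : is_symbol 0 F -> forall d a, F d a = 0.
Proof.
move=> [_ pF _ xF] d.
apply: (poly_on_lines_eq0 k_char0 (s := const_mx 1) (pF d)).
move=> a; exists (\sum_i (`|a ord0 i| + `|d ord0 i|))%N => t Tt.
have le i : (`|a ord0 i| + `|d ord0 i| <= t)%N.
  by apply: leq_trans Tt; rewrite (bigD1 i) //= leq_addr.
have Pa : is_expo L (a + const_mx 1 *+ t).
  apply/is_expoP => i _; rewrite mxE mulmxnE mxE natz.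
  by move: (le i); move: (a ord0 i) (d ord0 i) => z y; lia.
have Pad : is_expo L (a + const_mx 1 *+ t + d).
  apply/is_expoP => i _; rewrite 2!mxE mulmxnE mxE natz.
  by move: (le i); move: (a ord0 i) (d ord0 i) => z y; lia.
have := xF (Sub _ Pa) (Sub _ Pad); rewrite !SubK raddf0 => ->.
by rewrite [_ + d - _]addrAC subrr add0r.
Qed.

Lemma is_symbol_uniq x F G : is_symbol x F -> is_symbol x G -> F = G.
Proof.
move=> xF xG; apply/funext => d; apply/funext => a.
have : is_symbol 0 (fun d a => -1 * F d a + G d a).
  by have := is_symbol_linear (-1) xF xG; rewrite scaleN1r addNr.
by move/is_symbol0_eq0/(_ d a)/eqP; rewrite mulN1r addrC subr_eq0 => /eqP.
Qed.

Lemma is_symbol_eq0 x : is_symbol x (fun _ _ => 0) -> x = 0.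
Proof.
move=> [_ _ _ x0]; apply: endo_eqP => u; apply/eqP/freeg_eqP => v.
by rewrite x0 coeff0.
Qed.

(** The symbol of an operator homogeneous of degree [d], sending x^a to [c a] times x^(a + d). *)
Definition mono_symbol d (c : Zn -> k) : Zn -> Zn -> k :=
  fun e a => (e == d)%:R * c a.

Lemma mono_symbolE d c a : mono_symbol d c d a = c a.
Proof. by rewrite /mono_symbol eqxx mul1r. Qed.

Lemma mono_symbol_out d c e a : e != d -> mono_symbol d c e a = 0.
Proof. by rewrite /mono_symbol => /negPf ->; rewrite mulr0n mul0r. Qed.

Definition is_mono x d c := is_symbol x (mono_symbol d c).

Lemma mono_op_is_mono d c :
  poly_on_lines c ->
  (forall a i, i \notin L -> 0 <= a ord0 i -> a ord0 i + d ord0 i < 0 ->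
     c a = 0) ->
  is_mono (mono_op (fun u => c (val u)) (expo_shift d)) d c.
Proof.
move=> pc c0; split.
- exists [:: d] => e a; rewrite mem_seq1.
  by apply: contra_neqT; exact: mono_symbol_out.
- by move=> e; apply: poly_on_linesM => //; apply: poly_on_lines_cst.
- move=> e a i iL a0 ae0; have [ed|/mono_symbol_out->//] := eqVneq e d.
  by rewrite ed mono_symbolE (c0 a i) // -ed.
- move=> u v; rewrite mono_opE coeffZ coeffU mul1r /mono_symbol mulrC.
  have [cu|cu] := eqVneq (c (val u)) 0; first by rewrite cu !mulr0.
  have Pud : is_expo L (val u + d).
    apply/is_expoP => i iL; rewrite mxE leNgt; apply/negP => lt0.
    case/negP: cu; apply/eqP; apply: c0 lt0 => //.
    by have /is_expoP := valP u; apply.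
  congr ((_ : bool)%:R * _).
  by rewrite -val_eqE insubdK // eq_sym subr_eq addrC.
Qed.

Lemma is_monoM x d c y e b :
  is_mono x d c -> is_mono y e b ->
  is_mono (x * y) (d + e) (fun a => c (a + e) * b a).
Proof.
move=> xc yb.
have b0 e' a : mono_symbol e b e' a != 0 -> e' \in [:: e].
  by rewrite mem_seq1; apply: contra_neqT; exact: mono_symbol_out.
have := is_symbolM xc yb (erefl (uniq [:: e])) b0.
congr is_symbol; apply/funext => e'; apply/funext => a.
by rewrite big_seq1 mono_symbolE /mono_symbol subr_eq mulrA.
Qed.

Lemma is_mono_linear (s : k) x d c y b :
  is_mono x d c -> is_mono y d b ->
  is_mono (s *: x + y) d (fun a => s * c a + b a).
Proof.
move=> xc yb; have := is_symbol_linear s xc yb.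
congr is_symbol; apply/funext => e; apply/funext => a.
by rewrite /mono_symbol mulrDr mulrCA.
Qed.

Lemma is_mono1 : is_mono 1 0 (fun=> 1).
Proof.
have := @mono_op_is_mono 0 (fun=> 1) (poly_on_lines_cst 1).
rewrite (_ : mono_op _ _ = 1); last first.
  apply: endo_eqP => u; rewrite mono_opE scale1r; congr << _ >>.
  by apply: val_inj; rewrite /expo_shift addr0 insubdK //; exact: valP.
apply=> a i _ a0; by rewrite mxE addr0 ltNge a0.
Qed.

(** Reduces an identity of homogeneous operators to one of coefficient functions; the relations
    between raising and lowering operators are checked this way. *)
Lemma is_mono_uniq x y d c b :
  is_mono x d c -> is_mono y d b -> c =1 b -> x = y.
Proof.
move=> xc yb cb; apply/eqP; rewrite -subr_eq0; apply/eqP.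
apply: is_symbol_eq0; have := is_symbol_linear (-1) yb xc.
rewrite scaleN1r addrC; congr is_symbol; apply/funext => e; apply/funext => a.
by rewrite /mono_symbol cb mulN1r addNr.
Qed.

Local Notation ei i := (delta_mx ord0 i : Zn).

Lemma Qop_is_mono i : is_mono (Qop k L i) (ei i) (fun=> 1).
Proof.
apply: mono_op_is_mono => [|a j _ a0]; first exact: poly_on_lines_cst.
by rewrite mxE ltNge addr_ge0 // ler0n.
Qed.

Lemma Qinv_op_is_mono i : i \in L -> is_mono (Qinv_op k L i) (- ei i) (fun=> 1).
Proof.
move=> iL; apply: mono_op_is_mono => [|a j jL a0].
  exact: poly_on_lines_cst.
have ji : (j == i) = false by apply: contraNF jL => /eqP ->.
by rewrite !mxE ji andbF subr0 ltNge a0.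
Qed.

Lemma Pop_is_mono i : is_mono (Pop k L i) (- ei i) (fun a => (a ord0 i)%:~R).
Proof.
apply: mono_op_is_mono => [|a j jL]; first exact: poly_on_lines_coord.
rewrite !mxE eqxx; case: eqP => [->|_]; last by rewrite subr0 ltNge => ->.
case: (a ord0 i) => [[|m]|m] //=; lia.
Qed.

Lemma is_diffop1 : is_diffop (1 : E).
Proof. by move=> S [] //. Qed.

Lemma is_diffop_linear (c : k) x y :
  is_diffop x -> is_diffop y -> is_diffop (c *: x + y).
Proof.
move=> Dx Dy S S1 S2 S3 S4; case: (S1) => _ lS _.
by apply: lS; [exact: Dx|exact: Dy].
Qed.

Lemma is_diffopM x y : is_diffop x -> is_diffop y -> is_diffop (x * y).
Proof.
move=> Dx Dy S S1 S2 S3 S4; case: (S1) => _ _ mS.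
by apply: mS; [exact: Dx|exact: Dy].
Qed.

Lemma Qop_diffop i : is_diffop (Qop k L i).
Proof. by move=> S _ SQ _ _; exact: SQ. Qed.

Lemma Qinv_op_diffop i : i \in L -> is_diffop (Qinv_op k L i).
Proof. by move=> iL S _ _ SQ _; exact: SQ. Qed.

Lemma Pop_diffop i : is_diffop (Pop k L i).
Proof. by move=> S _ _ _ SP; exact: SP. Qed.

(** The operators that have a symbol form a subalgebra containing all the generators. *)
Lemma is_diffop_symbol x : is_diffop x -> exists F, is_symbol x F.
Proof.
pose S : {pred E} := [pred x | `[< exists F, is_symbol x F >]].
move=> /(_ S) Sx; apply/asboolP; apply: Sx.
- split=> [|c y z /asboolP[F yF] /asboolP[G zG]
           |y z /asboolP[F yF] /asboolP[G zG]].
  + by apply/asboolP; eexists; exact: is_mono1.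
  + by apply/asboolP; eexists; apply: is_symbol_linear yF zG.
  + have [[D GD] _ _ _] := zG; apply/asboolP; eexists.
    apply: (is_symbolM yF zG (undup_uniq D)) => d a /GD.
    by rewrite mem_undup.
- by move=> i; apply/asboolP; eexists; exact: Qop_is_mono.
- by move=> i iL; apply/asboolP; eexists; exact: Qinv_op_is_mono.
- by move=> i; apply/asboolP; eexists; exact: Pop_is_mono.
Qed.

Definition symbol x : Zn -> Zn -> k :=
  xget (fun _ _ => 0) [set F | is_symbol x F].

Lemma symbolP x : is_diffop x -> is_symbol x (symbol x).
Proof. by case/is_diffop_symbol => F; exact: xgetI. Qed.

Lemma symbol_eq x F : is_symbol x F -> symbol x = F.
Proof. by move=> xF; apply: is_symbol_uniq (xgetI _ xF) xF. Qed.

End Symbols.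

(** * Simple modules on boxes of weights *)

Section MatrixModules.
Variables (k : fieldType) (R : algType k) (N : nat) (rho : R -> 'M[k]_N).
Hypothesis rho_linear : linear rho.
Hypothesis rho1 : rho 1 = 1%:M.
Hypothesis rhoM : forall x y, rho (x * y) = rho x *m rho y.

(* The unused arguments let the module structure be inferred from the type. *)
Definition matrix_module of linear rho & rho 1 = 1%:M &
  (forall x y, rho (x * y) = rho x *m rho y) : Type := 'cV[k]_N.

Local Notation M := (matrix_module rho_linear rho1 rhoM).

HB.instance Definition _ := GRing.Zmodule.on M.

Let scale (x : R) (u : M) : M := rho x *m u.

Fact matrix_module_scaleA x y u : scale x (scale y u) = scale (x * y) u.
Proof. by rewrite /scale rhoM mulmxA. Qed.
Fact matrix_module_scale1 : left_id 1 scale.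
Proof. by move=> u; rewrite /scale rho1 mul1mx. Qed.
Fact matrix_module_scaleDr : right_distributive scale +%R.
Proof. by move=> x u v; exact: mulmxDr. Qed.
Fact matrix_module_scaleDl u : {morph scale^~ u : x y / x + y}.
Proof.
move=> x y; rewrite /scale -mulmxDl; congr (_ *m _).
by have := rho_linear 1 x y; rewrite !scale1r.
Qed.

HB.instance Definition _ := GRing.Zmodule_isLmodule.Build R M
  matrix_module_scaleA matrix_module_scale1 matrix_module_scaleDr
  matrix_module_scaleDl.

Lemma matrix_moduleE x (u : M) : x *: u = rho x *m u.
Proof. by []. Qed.

Lemma rho_alg c : rho c%:A = c%:M.
Proof.
have rho0 : rho 0 = 0.
  by have := rho_linear (-1) 0 0; rewrite scaleN1r oppr0 addr0 scaleN1r addNr.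
by have := rho_linear c 1 0; rewrite rho0 !addr0 rho1 scalemx1.
Qed.

Lemma matrix_module_fin_dim : fin_dim M.
Proof.
exists N, (fun i => delta_mx i 0 : 'cV[k]_N) => u.
exists (fun i => (u : 'cV_N) i 0).
rewrite {1}(matrix_sum_delta (u : 'cV[k]_N)); apply: eq_bigr => i _.
by rewrite big_ord1 matrix_moduleE rho_alg mul_scalar_mx.
Qed.

(** If a vector [u] of a submodule has a nonzero entry at [j], the matrix units [delta_mx i j] carry
    it to nonzero multiples of all the basis vectors. *)
Lemma matrix_module_simple :
  (0 < N)%N ->
  (forall i j, exists x c, c != 0 /\ rho x = c *: delta_mx i j) ->
  simple_mod M.
Proof.
move=> N0 full; split.
  exists (const_mx 1 : 'cV[k]_N); apply/eqP => /matrixP/(_ (Ordinal N0) 0).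
  by rewrite !mxE => /eqP; rewrite oner_eq0.
move=> S [S0 SL].
have SZ x u : u \in S -> x *: u \in S.
  by move=> uS; have := SL x u 0 uS S0; rewrite addr0.
have SD u v : u \in S -> v \in S -> u + v \in S.
  by move=> uS; have := SL 1 u v uS; rewrite scale1r.
have [[u uS u0]|none] := pselect (exists2 u, u \in S & u != 0); last first.
  left=> u; rewrite inE; apply/idP/eqP => [uS|->//].
  by apply: contrapT => /eqP u0; apply: none; exists u.
right=> v; rewrite [RHS]inE.
have [j uj] : exists j, (u : 'cV[k]_N) j 0 != 0.
  apply: contrapT => nex; case/negP: u0; apply/eqP/matrixP => j l.
  rewrite ord1 [RHS]mxE; apply: contrapT => /eqP uj.
  by apply: nex; exists j.
have eS i : (delta_mx i 0 : M) \in S.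
  have [x [c [c0 xE]]] := full i j.
  suff -> : delta_mx i 0 = (c * (u : 'cV[k]_N) j 0)^-1%:A *: (x *: u) :> M.
    by exact/SZ/SZ.
  rewrite !matrix_moduleE rho_alg mul_scalar_mx xE -scalemxAl scalerA invfM.
  rewrite -mulrA [_ * c]mulrC mulrA mulVf // mul1r.
  apply/matrixP => l m; rewrite ord1 !mxE eqxx andbT (bigD1 j) //= big1.
    by rewrite addr0 !mxE eqxx andbT mulrC -mulrA mulfV // mulr1.
  by move=> m' /negPf mj; rewrite !mxE mj andbF mul0r.
rewrite (matrix_sum_delta (v : 'cV[k]_N)); elim/big_rec: _ => // i w _ wS.
apply: (SD) => //; rewrite big_ord1.
have := SZ ((v : 'cV[k]_N) i 0)%:A _ (eS i).
by rewrite matrix_moduleE rho_alg mul_scalar_mx.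
Qed.

End MatrixModules.

(** * Characters of the diagonal torus *)

Section Monomials.
Variables (k : fieldType) (n : nat).
Implicit Types (c : 'rV[k]_n) (a : 'rV[int]_n).

Definition monom c a : k := \prod_i c ord0 i ^ a ord0 i.

Lemma monom_neq0 c a : Gm k n c -> monom c a != 0.
Proof. by move=> c0; apply/prodf_neq0 => i _; apply: expfz_neq0. Qed.

Lemma monomD c a b : Gm k n c -> monom c (a + b) = monom c a * monom c b.
Proof.
move=> c0; rewrite -big_split; apply: eq_bigr => i _.
by rewrite mxE expfzDr //; exact: c0.
Qed.

Lemma monom0 c : monom c 0 = 1.
Proof. by rewrite /monom big1 // => i _; rewrite mxE expr0z. Qed.

Lemma monomN c a : Gm k n c -> monom c (- a) = (monom c a)^-1.
Proof.
move=> c0; apply: (mulfI (monom_neq0 a c0)).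
by rewrite -monomD // subrr monom0 mulfV ?monom_neq0.
Qed.

Lemma monom_inv c a : Gm k n c -> monom (map_mx GRing.inv c) a = monom c (- a).
Proof.
by move=> c0; apply: eq_bigr => i _; rewrite !mxE exprz_inv.
Qed.

Lemma monom_dact c d a : monom (dact c d) a = monom c a * monom d a.
Proof.
by rewrite -big_split; apply: eq_bigr => i _; rewrite mxE expfzMl.
Qed.

Lemma monom_delta c i (z : int) : monom c (z *: delta_mx ord0 i) = c ord0 i ^ z.
Proof.
rewrite /monom (bigD1 i) //= big1 ?mulr1 => [|j /negPf ji].
  by rewrite !mxE !eqxx mulr1.
by rewrite !mxE ji andbF mulr0 expr0z.
Qed.

End Monomials.

Lemma monomZ (k : fieldType) n (c : 'rV[k]_n) (z : int) a :
  monom c (z *: a) = monom c a ^ z.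
Proof.
rewrite /monom (big_morph (fun y : k => y ^ z) (id1 := 1) (op1 := *%R)).
- by apply: eq_bigr => i _; rewrite mxE mulrC exprz_exp.
- by move=> x y; rewrite expfzMl.
- exact: exp1rz.
Qed.

Lemma monom_lincomb (k : fieldType) m (I : finType) (A : I -> 'rV[int]_m)
    (e : I -> int) (g : 'rV[k]_m) : Gm k m g ->
  \prod_i monom g (A i) ^ e i = monom g (\sum_i e i *: A i).
Proof.
move=> g0; rewrite (big_morph (monom g) (id1 := 1) (op1 := *%R)) ?monom0 //.
  by apply: eq_bigr => i _; rewrite monomZ.
by move=> a b; exact: monomD.
Qed.

Section InvariantSymbols.
Variables (k : fieldType) (k_char0 : [pchar k] =i pred0).
Variables (n : nat) (L : {set 'I_n}) (C : set 'rV[k]_n).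
Local Notation E := (endo k L).
Local Notation Zn := 'rV[int]_n.
Implicit Types (x y : E) (a d : Zn) (u v : expo L).

(** Conjugation by [c] multiplies the component of degree [d] of an operator by [monom c d], so
    these are the degrees that can occur in an invariant operator. *)
Definition invariant_weight d :=
  forall c, C c -> Gm k n c -> monom c d = 1.

Lemma invariant_weight0 : invariant_weight 0.
Proof. by move=> c _ _; exact: monom0. Qed.

Lemma invariant_weightD a d :
  invariant_weight a -> invariant_weight d -> invariant_weight (a + d).
Proof. by move=> wa wd c Cc c0; rewrite monomD // wa // wd // mulr1. Qed.

Lemma invariant_weightN d : invariant_weight d -> invariant_weight (- d).
Proof. by move=> wd c Cc c0; rewrite monomN // wd // invr1. Qed.

Lemma coeff_diag_op c (f : coord_ring k L) v :
  coeff v (diag_op L c f) = monom c (val v) * coeff v f.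
Proof.
rewrite -[f in RHS]/((1 : E) f) !coeff_endo mulr_sumr; apply: eq_bigr => u _.
rewrite mono_opE coeffZ coeffU mul1r mulrCA.
by have [->//|] := eqVneq u v; rewrite !mulr0.
Qed.

Lemma coeff_diag_conj c x u v : Gm k n c ->
  coeff v (diag_conj c x << u >>) =
  monom c (val v - val u) * coeff v (x << u >>).
Proof.
move=> c0; rewrite /diag_conj !endoM mono_opE.
rewrite -[X in X *: _]/(monom (map_mx GRing.inv c) (val u)) !linearZZ.
by rewrite coeffZ coeff_diag_op monom_inv // mulrA -monomD // addrC.
Qed.

Lemma is_symbol_diag_conj c x F : Gm k n c -> is_symbol x F ->
  is_symbol (diag_conj c x) (fun d a => monom c d * F d a).
Proof.
move=> c0 [[D FD] pF F0 xF]; split.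
- exists D => d a; rewrite mulf_eq0 negb_or => /andP[_]; exact: FD.
- move=> d; apply: poly_on_linesM => //; exact: poly_on_lines_cst.
- by move=> d a i iL a0 ad0; rewrite (F0 d a i) // mulr0.
- by move=> u v; rewrite coeff_diag_conj // xF.
Qed.

Lemma mono_inv_diffop x d c :
  is_diffop x -> is_mono x d c -> invariant_weight d -> x \in inv_diffop C.
Proof.
move=> Dx xc wd; apply/asboolP; split=> // g Cg g0.
apply: endo_eqP => u; apply/eqP/freeg_eqP => v; rewrite coeff_diag_conj //.
have [_ _ _ ->] := xc; have [->|/mono_symbol_out->] := eqVneq (val v - val u) d.
  by rewrite wd // mul1r.
by rewrite mulr0.
Qed.

Lemma inv_diffop_is_diffop x : x \in inv_diffop C -> is_diffop x.
Proof. by move=> /asboolP[]. Qed.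

Lemma symbol_weight x d a :
  x \in inv_diffop C -> symbol x d a != 0 -> invariant_weight d.
Proof.
move=> xI Fd c Cc c0; have Dx := inv_diffop_is_diffop xI.
have xF := symbolP Dx; have /asboolP[_ /(_ c Cc c0) xc] := xI.
have := is_symbol_diag_conj c0 xF; rewrite xc => /(is_symbol_uniq k_char0 xF).
move=> /(congr1 (fun F => F d a)) FE; apply: (mulIf Fd).
by rewrite -FE mul1r.
Qed.

End InvariantSymbols.

(** * Exponents with a prescribed sign pattern *)

Section Box.
Variables (k : fieldType) (k_char0 : [pchar k] =i pred0).
Variables (n : nat) (L : {set 'I_n}) (sg : 'I_n -> bool).
Local Notation E := (endo k L).
Local Notation Zn := 'rV[int]_n.
Implicit Types (x y : E) (a b d : Zn).

(** Where [sg i] is false, the monomials are those of k[x_i, 1/x_i] / k[x_i] instead of k[x_i]. *)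
Definition box a := forall i, i \notin L -> (0 <= a ord0 i) = sg i.

Definition transferable a b := exists x c,
  [/\ is_diffop x, is_mono x (b - a) c & c a != 0].

Lemma transferable_refl a : transferable a a.
Proof.
exists 1, (fun=> 1); rewrite subrr oner_eq0; split=> //.
  exact: is_diffop1.
exact: is_mono1.
Qed.

Lemma transferable_trans a b d :
  transferable a b -> transferable b d -> transferable a d.
Proof.
move=> [x [c [Dx xc ca]]] [y [e [Dy ye eb]]].
exists (y * x), (fun u => e (u + (b - a)) * c u); split.
- exact: is_diffopM.
- by have := is_monoM ye xc; rewrite addrA subrK.
- by rewrite subrKC mulf_neq0.
Qed.

(** Induction on the l1-distance: one step towards [b] in a single coordinate stays in the box and
    is realised by [Qop], [Qinv_op] or [Pop]. *)
Lemma box_transferable a b : box a -> box b -> transferable a b.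
Proof.
have [N le] : exists N, (\sum_i `|b ord0 i - a ord0 i| <= N)%N by eexists.
elim: N a le => [|N IH] a le Ba Bb.
  suff -> : a = b by exact: transferable_refl.
  apply/rowP => i; move: le; rewrite leqn0 sum_nat_eq0 => /forallP/(_ i)/=.
  by rewrite absz_eq0 subr_eq0 => /eqP.
have [->|ab] := eqVneq a b; first exact: transferable_refl.
have [i abi] : exists i, a ord0 i != b ord0 i.
  by apply/existsP; apply: contraNT ab; rewrite negb_exists =>
    /forallP ab; apply/eqP/rowP => i; apply/eqP; rewrite -[_ == _]negbK ab.
pose e : int := if a ord0 i < b ord0 i then 1 else -1.
pose a' := a + e *: delta_mx ord0 i.
have a'i : a' ord0 i = a ord0 i + e by rewrite !mxE !eqxx mulr1.
have a'j j : j != i -> a' ord0 j = a ord0 j.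
  by move=> /negPf ji; rewrite !mxE ji andbF mulr0 addr0.
have Ba' : box a'.
  move=> j jL; have [ji|ji] := eqVneq j i; last by rewrite a'j // Ba.
  rewrite ji in jL *; rewrite -(Ba i jL); have := Bb i jL; rewrite -(Ba i jL).
  rewrite a'i /e; move: abi; move: (a ord0 i) (b ord0 i) => p q.
  by case: ifP; lia.
have le' : (\sum_j `|b ord0 j - a' ord0 j| <= N)%N.
  rewrite -ltnS; apply: leq_trans le.
  rewrite (bigD1 i) //= [X in (_ < X)%N](bigD1 i) //=.
  under eq_bigr => j ji do rewrite a'j //.
  rewrite ltn_add2r a'i /e; move: abi; move: (a ord0 i) (b ord0 i) => p q.
  case: ifP; lia.
apply: (transferable_trans _ (IH a' le' Ba' Bb)).
rewrite /transferable /a' addrC addKr /e; case: ifP => ltab.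
  exists (Qop k L i), (fun=> 1); rewrite scale1r oner_eq0.
  by split; [exact: Qop_diffop|exact: Qop_is_mono|].
rewrite scaleN1r; case: (boolP (i \in L)) => iL.
  exists (Qinv_op k L i), (fun=> 1); rewrite oner_eq0.
  by split; [exact: Qinv_op_diffop|exact: Qinv_op_is_mono|].
exists (Pop k L i), (fun u => (u ord0 i)%:~R); split; first exact: Pop_diffop.
  exact: Pop_is_mono.
(* The coordinate has to decrease here, so if it were 0 in [a] it would be negative in [b], on the
   other side of the box. Hence the coefficient of [Pop] is nonzero. *)
rewrite pchar0_intr_eq0 //; have := Ba i iL; rewrite -(Bb i iL).
move: ltab abi; move: (a ord0 i) (b ord0 i) => p q.
lia.
Qed.

Definition theta i : E := Qop k L i * Pop k L i.

Lemma theta_diffop i : is_diffop (theta i).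
Proof. by apply: is_diffopM; [exact: Qop_diffop|exact: Pop_diffop]. Qed.

Lemma theta_is_mono i : is_mono (theta i) 0 (fun a => (a ord0 i)%:~R).
Proof.
have := is_monoM (Qop_is_mono k L i) (Pop_is_mono k L i).
by rewrite subrr; congr is_mono; apply/funext => a; rewrite mul1r.
Qed.

(** A product of factors [theta i] minus b_i, one for each [b] in [s], with [i] a coordinate in
    which [a] and [b] differ. *)
Lemma separating_operator a (s : seq Zn) : a \notin s -> exists x c,
  [/\ is_diffop x, is_mono x 0 c, c a != 0 & forall b, b \in s -> c b = 0].
Proof.
elim: s => [_|b s IH].
  exists 1, (fun=> 1); rewrite oner_eq0.
  by split=> //; [exact: is_diffop1|exact: is_mono1].
rewrite inE negb_or => /andP[ab /IH[x [c [Dx xc ca cs]]]].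
have [i abi] : exists i, a ord0 i != b ord0 i.
  by apply/existsP; apply: contraNT ab; rewrite negb_exists =>
    /forallP ab; apply/eqP/rowP => i; apply/eqP; rewrite -[_ == _]negbK ab.
pose t : E := - (b ord0 i)%:~R *: 1 + theta i.
exists (t * x), (fun d => (- (b ord0 i)%:~R + (d ord0 i)%:~R) * c d); split.
- apply: is_diffopM => //; apply: is_diffop_linear.
    exact: is_diffop1.
  exact: theta_diffop.
- have tc := is_mono_linear (- (b ord0 i)%:~R) (is_mono1 k L) (theta_is_mono i).
  have := is_monoM tc xc; rewrite addr0; congr is_mono.
  by apply/funext => d; rewrite addr0 mulr1.
- rewrite mulf_neq0 // addrC subr_eq0; apply: contra_neq abi.
  exact: pchar0_intr_inj.
- move=> d; rewrite inE => /predU1P[->|/cs->]; last by rewrite mulr0.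
  by rewrite addNr mul0r.
Qed.

End Box.

Section BoxModules.
Variables (k : fieldType) (k_char0 : [pchar k] =i pred0).
Variables (n : nat) (L : {set 'I_n}) (sg : 'I_n -> bool) (C : set 'rV[k]_n).
Local Notation R := (inv_diffops L C).
Local Notation Zn := 'rV[int]_n.
Implicit Types (x y : R) (a b d : Zn).

Lemma inv_diffops_diffop x : is_diffop (val x).
Proof. exact: inv_diffop_is_diffop (valP x). Qed.

Variables (W : seq Zn) (a0 : Zn).
Hypothesis uW : uniq W.
Hypothesis WP : forall b,
  reflect (box L sg b /\ invariant_weight C (b - a0)) (b \in W).

(** The action on the span of the monomials with exponents in [W]; terms of the symbol that leave
    the box are dropped. *)
Definition box_matrix x : 'M[k]_(size W) :=
  \matrix_(i, j) symbol (val x) (W`_i - W`_j) W`_j.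

Lemma box_matrix_linear : linear box_matrix.
Proof.
move=> s x y; apply/matrixP => i j; rewrite !mxE.
have xF := symbolP (inv_diffops_diffop x).
have yF := symbolP (inv_diffops_diffop y).
by rewrite linearP (symbol_eq k_char0 (is_symbol_linear s xF yF)).
Qed.

Lemma box_matrix1 : box_matrix 1 = 1%:M.
Proof.
apply/matrixP => i j; rewrite !mxE rmorph1 (symbol_eq k_char0 (is_mono1 k L)).
by rewrite /mono_symbol mulr1 subr_eq0 nth_uniq.
Qed.

(** No contributing path between two weights of the box leaves it: if [sg l] holds, [y] cannot bring
    the coordinate [l] below 0, and otherwise [x] cannot bring it back below 0. *)
Lemma box_matrixM x y : box_matrix (x * y) = box_matrix x *m box_matrix y.
Proof.
apply/matrixP => i j; rewrite !mxE rmorphM.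
have xF := symbolP (inv_diffops_diffop x).
have yF := symbolP (inv_diffops_diffop y).
have [[D FD] _ yF0 _] := yF; have [_ _ xF0 _] := xF.
have FD' d a : symbol (val y) d a != 0 -> d \in undup D.
  by rewrite mem_undup; exact: FD.
rewrite (symbol_eq k_char0 (is_symbolM xF yF (undup_uniq D) FD')).
pose H e := symbol (val x) (W`_i - W`_j - e) (W`_j + e) * symbol (val y) e W`_j.
transitivity (\sum_(e <- [seq b - W`_j | b <- W]) H e); last first.
  rewrite big_map (big_nth 0) big_mkord; apply: eq_bigr => l _; rewrite !mxE /H.
  by rewrite subrKC; congr (symbol _ _ _ * _); rewrite opprB addrA subrK.
apply: eq_big_support; first exact: undup_uniq.
  by rewrite map_inj_uniq // => b b' /addIr.
move=> e; rewrite mulf_eq0 negb_or => /andP[xe ye]; rewrite (FD' _ _ ye).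
apply/esym/mapP; exists (W`_j + e); last by rewrite addrC addKr.
have /WP[jbox jw] := mem_nth 0 (ltn_ord j).
have /WP[ibox _] := mem_nth 0 (ltn_ord i).
have ew := symbol_weight k_char0 (valP y) ye.
apply/WP; split; last by rewrite addrAC; exact: invariant_weightD.
move=> l lL; rewrite mxE; have := jbox l lL; have := ibox l lL.
case: (sg l) => [il jl|il jl].
  by apply: contraNT ye; rewrite -ltNge => lt0; rewrite (yF0 e _ l).
apply/negbTE; apply: contraNN xe => je0; rewrite (xF0 _ _ l) ?mxE //.
by move: il; move: (W`_i ord0 l) (W`_j ord0 l) (e ord0 l) => p q r; lia.
Qed.

(** A separating operator kills every weight of [W] but the [j]-th, which a transfer operator then
    moves to the [i]-th. The product is invariant, as its degree is a difference of two weights of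
    one coset. *)
Lemma box_matrix_full i j :
  exists x c, c != 0 /\ box_matrix x = c *: delta_mx i j.
Proof.
have /WP[jbox jw] := mem_nth 0 (ltn_ord j).
have /WP[ibox iw] := mem_nth 0 (ltn_ord i).
have [t [c [Dt tc cj]]] := box_transferable k_char0 jbox ibox.
have jN : W`_j \notin rem W`_j W by rewrite mem_rem_uniqF.
have [p [e [Dp pe ej e0]]] := separating_operator k_char0 L jN.
have Dtp := is_diffopM Dt Dp; have tpc := is_monoM tc pe.
have wij : invariant_weight C (W`_i - W`_j + 0).
  have -> : W`_i - W`_j + 0 = (W`_i - a0) + - (W`_j - a0).
    by rewrite addr0 opprB addrA subrK.
  by apply: invariant_weightD => //; exact: invariant_weightN.
have tpI : inv_diffop C (t * p) := mono_inv_diffop Dtp tpc wij.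
exists (Sub (t * p) tpI : R), (c W`_j * e W`_j); split.
  exact: mulf_neq0.
apply/matrixP => i' j'; rewrite !mxE SubK (symbol_eq k_char0 tpc).
rewrite /mono_symbol !addr0.
have [->|jj] := eqVneq j' j.
  by rewrite (can_eq (addrNK _)) nth_uniq // andbT mulrC.
rewrite e0 ?mulr0 ?andbF ?mulr0 //.
by rewrite mem_rem_uniq // !inE nth_uniq // jj mem_nth.
Qed.

Lemma box_module_annihilator x :
  box L sg a0 ->
  (forall M : lmodType R, simple_mod M -> fin_dim M ->
     forall u : M, x *: u = 0) ->
  forall b, box L sg b -> invariant_weight C (b - a0) ->
  symbol (val x) (b - a0) a0 = 0.
Proof.
move=> Ba0 x0 b Bb wb.
pose M : lmodType R := matrix_module box_matrix_linear box_matrix1 box_matrixM.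
have a0W : a0 \in W.
  by apply/WP; split=> //; rewrite subrr; exact: invariant_weight0.
have bW : b \in W by apply/WP.
have Msimple : simple_mod M.
  apply: matrix_module_simple; last exact: box_matrix_full.
  by move: a0W; rewrite -index_mem; exact: leq_trans.
have ltb : (index b W < size W)%N by rewrite index_mem.
have lta : (index a0 W < size W)%N by rewrite index_mem.
have := x0 M Msimple (matrix_module_fin_dim _ _ _)
  (delta_mx (Ordinal lta) 0 : 'cV[k]_(size W)).
rewrite matrix_moduleE -colE => /matrixP/(_ (Ordinal ltb) 0).
by rewrite !mxE /= !nth_index.
Qed.

End BoxModules.

(** The symbol of an annihilating operator vanishes at all points deep inside the box, reached in
    the direction with entries 1 or -1 according to [sg], hence everywhere by polynomiality. *)
Lemma enough_simple_fin_dim_box (k : fieldType) (k_char0 : [pchar k] =i pred0)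
    (n : nat) (L : {set 'I_n}) (sg : 'I_n -> bool) (C : set 'rV[k]_n) :
  (forall a0, finite_set [set b | box L sg b /\ invariant_weight C (b - a0)]) ->
  enough_simple_fin_dim (inv_diffops L C).
Proof.
move=> fin x x0; apply: val_inj; apply: (@is_symbol_eq0 k n L).
have xF := symbolP (inv_diffops_diffop x).
suff -> : (fun _ _ => 0) = symbol (val x) by [].
apply/funext => d; apply/funext => a; apply/esym.
have [wd|nwd] := pselect (invariant_weight C d); last first.
  apply: contrapT => /eqP xda; apply: nwd; exact: symbol_weight (valP x) xda.
move: a.
apply: (poly_on_lines_eq0 k_char0 (s := \row_i (if sg i then 1 else -1))).
  by case: xF.
(* The successor in the bound serves the coordinates that have to be strictly negative. *)
move=> a; exists (\sum_i (`|a ord0 i| + `|d ord0 i|)).+1 => t Tt.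
set b := a + _.
have Bb : box L sg b /\ box L sg (b + d).
  have le i : (`|a ord0 i| + `|d ord0 i| < t)%N.
    by apply: leq_trans Tt; rewrite ltnS (bigD1 i) //= leq_addr.
  split=> i iL; have := le i; rewrite !mxE mulmxnE mxE.
    move: (a ord0 i) (d ord0 i) => p q.
    by case: (sg i); rewrite ?mulNrn natz; lia.
  move: (a ord0 i) (d ord0 i) => p q.
  by case: (sg i); rewrite ?mulNrn natz; lia.
have [W0 WE] := (finite_seqP _).1 (fin b).
have := @box_module_annihilator k k_char0 n L sg C (undup W0) b (undup_uniq W0)
  _ x Bb.1 x0 (b + d) Bb.2; rewrite [b + d]addrC addrK; apply=> // a'.
apply: (iffP idP); rewrite mem_undup.
  by move=> aW; have : [set` W0] a' by []; rewrite -WE.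
by move=> H; have : [set` W0] a' by rewrite -WE.
Qed.

(** * Finiteness criteria in terms of weights *)

(** On a coset of invariant weights the sum of the mu_i b_i is constant, and in the box with the
    signs of [mu] its terms are nonnegative. So the coordinates outside [L] are bounded, and by the
    last hypothesis they determine the weight. *)
Lemma enough_simple_fin_dim_weights (k : fieldType)
    (k_char0 : [pchar k] =i pred0) (n : nat) (L : {set 'I_n})
    (C : set 'rV[k]_n) (mu : 'I_n -> int) :
  (forall i, i \notin L -> mu i != 0) ->
  (forall d, invariant_weight C d ->
     \sum_(i | i \notin L) mu i * d ord0 i = 0) ->
  (forall d, invariant_weight C d -> (forall i, i \notin L -> d ord0 i = 0) ->
     d = 0) ->
  enough_simple_fin_dim (inv_diffops L C).
Proof.
move=> mu0 Cmu Cinj; pose sg i : bool := 0 < mu i.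
apply: (enough_simple_fin_dim_box k_char0 (sg := sg)) => a0.
set A := [set b | _]; pose K := `|(\sum_(i | i \notin L) mu i * a0 ord0 i)%R|%N.
have AK b i : A b -> i \notin L -> (`|b ord0 i| <= K)%N.
  move=> [Bb wb] iL.
  have KE : \sum_(i | i \notin L) mu i * b ord0 i =
      \sum_(i | i \notin L) mu i * a0 ord0 i.
    apply/eqP; rewrite -subr_eq0 -sumrB; apply/eqP; rewrite -[RHS](Cmu _ wb).
    by apply: eq_bigr => j _; rewrite !mxE mulrBr.
  have mub j : j \notin L -> 0 <= mu j * b ord0 j.
    move=> jL; have := Bb j jL; have := mu0 j jL; rewrite /sg.
    by move: (mu j) (b ord0 j) => p q; nia.
  have : mu i * b ord0 i <= \sum_(i | i \notin L) mu i * a0 ord0 i.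
    by rewrite -KE (bigD1 i) //= lerDl sumr_ge0 // => j /andP[/mub].
  have := mub i iL; have := mu0 i iL; rewrite /K.
  by move: (\sum_(i | _) _) (mu i) (b ord0 i) => z p q; nia.
pose f (b : 'rV[int]_n) : {ffun 'I_n -> 'I_K.+1} :=
  [ffun i => if i \in L then ord0 else inord `|b ord0 i|].
have fI : {in A &, injective f}.
  move=> b b' /set_mem Ab /set_mem Ab' /ffunP bb'.
  apply/eqP; rewrite -subr_eq0; apply/eqP; apply: Cinj.
    have [_ wb] := Ab; have [_ wb'] := Ab'.
    have -> : b - b' = (b - a0) + - (b' - a0) by rewrite opprB addrA subrK.
    by apply: invariant_weightD => //; exact: invariant_weightN.
  move=> i iL; have := bb' i; rewrite !ffunE (negPf iL).
  move=> /(congr1 val); rewrite /= !inordK ?ltnS ?AK // !mxE.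
  have [/(_ i iL) + _] := Ab; have [/(_ i iL) <- _] := Ab'.
  by move: (b ord0 i) (b' ord0 i) => p q; lia.
rewrite -(eq_finite_set (inj_card_eq fI)); exact: finite_finset.
Qed.

Section NoFiniteDimensionalModule.
Variables (k : closedFieldType) (k_char0 : [pchar k] =i pred0).
Variables (n : nat) (L : {set 'I_n}) (C : set 'rV[k]_n).
Local Notation E := (endo k L).
Local Notation Zn := 'rV[int]_n.
Local Notation ei i := (delta_mx ord0 i : Zn).
Implicit Types (x y : E) (d : Zn).

Lemma is_mono_prod0 (I : Type) (r : seq I) (f : I -> E) (c : I -> Zn -> k) :
  (forall i, is_mono (f i) 0 (c i)) ->
  is_mono (\prod_(i <- r) f i) 0 (fun a => \prod_(i <- r) c i a).
Proof.
move=> fc; elim: r => [|i r IH].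
  rewrite big_nil; have := is_mono1 k L; congr is_mono.
  by apply/funext => a; rewrite big_nil.
rewrite big_cons; have := is_monoM (fc i) IH; rewrite addr0; congr is_mono.
by apply/funext => a; rewrite addr0 big_cons.
Qed.

Lemma monomial_operator d :
  (forall i, i \notin L -> 0 <= d ord0 i) ->
  exists x, is_diffop x /\ is_mono x d (fun=> 1).
Proof.
move=> d0; pose P d := exists x, is_diffop x /\ is_mono x d (fun=> 1).
have P0 : P 0 by exists 1; split; [exact: is_diffop1|exact: is_mono1].
have PD a b : P a -> P b -> P (a + b).
  move=> [x [Dx xa]] [y [Dy yb]]; exists (x * y); split.
    exact: is_diffopM.
  have := is_monoM xa yb; congr is_mono.
  by apply/funext => u; rewrite mulr1.
have PMn a m : P a -> P (a *+ m).
  by move=> Pa; elim: m => [|m IH]; rewrite ?mulr0n ?mulrS //; exact: PD.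
rewrite -/(P d) (matrix_sum_delta d) big_ord1; apply: big_ind => // i _.
have Pe : P (ei i).
  by exists (Qop k L i); split; [exact: Qop_diffop|exact: Qop_is_mono].
case E: (d ord0 i) => [m|m].
  by rewrite -[Posz m]natz scaler_nat; exact: PMn.
have iL : i \in L by apply: contraT => /d0; rewrite E.
rewrite NegzE -natz scaleNr scaler_nat -mulNrn; apply: PMn.
exists (Qinv_op k L i).
by split; [exact: Qinv_op_diffop|exact: Qinv_op_is_mono].
Qed.

Lemma Pop_power i N : is_diffop (Pop k L i ^+ N) /\
  is_mono (Pop k L i ^+ N) (- ei i *+ N)
    (fun a => \prod_(l < N) ((a ord0 i)%:~R - l%:R)).
Proof.
elim: N => [|N [DN IH]].
  rewrite expr0; split; first exact: is_diffop1.
  have := is_mono1 k L; rewrite mulr0n; congr is_mono.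
  by apply/funext => a; rewrite big_ord0.
rewrite exprS; split; first by apply: is_diffopM => //; exact: Pop_diffop.
have := is_monoM (Pop_is_mono k L i) IH; rewrite -mulrS; congr is_mono.
apply/funext => a; rewrite big_ord_recr /= mulrC; congr (_ * _).
by rewrite mxE mulmxnE !mxE !eqxx rmorphD rmorphMn rmorphN mulNrn.
Qed.

(** The elements [x], [a] and [b] of [no_fin_dim_module] become [theta], the monomial of exponent
    [d] and an operator of degree [- d]. *)
Lemma no_fin_dim_inv_diffops (i : 'I_n) (N : nat) d :
  (0 < N)%N -> d ord0 i = N -> (forall j, j \notin L -> 0 <= d ord0 j) ->
  (forall j, j \notin L -> j != i -> d ord0 j = 0) ->
  invariant_weight C d ->
  forall M : lmodType (inv_diffops L C), fin_dim M -> ~ nonzero_mod M.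
Proof.
move=> N0 di d0 dL wd.
have [a [Da ad]] := monomial_operator d0.
(* The degree [- d] splits into [- N] at [i], contributed by the power of [Pop], and an exponent
   that vanishes at every coordinate outside [L]. *)
have [|b [Db bd]] := @monomial_operator (- d + ei i *+ N).
  move=> j jL; rewrite !mxE mulmxnE !mxE eqxx /=.
  have [->|ji] := eqVneq j i; first by rewrite di mulr1n natz addNr.
  by rewrite dL // mul0rn subrr.
have [DP PN] := Pop_power i N.
have Dc := is_diffopM DP Db; have cd := is_monoM PN bd.
have wN := invariant_weightN wd.
have dE : - ei i *+ N + (- d + ei i *+ N) = - d.
  by rewrite mulNrn addrC addrK.
have {}cd : is_mono (Pop k L i ^+ N * b) (- d)
    (fun a => \prod_(l < N) ((a ord0 i)%:~R - l%:R)).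
  move: cd; rewrite dE; congr is_mono; apply/funext => u; rewrite mulr1.
  apply: eq_bigr => l _; congr (_%:~R - _).
  by rewrite !mxE mulmxnE !mxE !eqxx di mulr1n natz addNr addr0.
have aI : inv_diffop C a := mono_inv_diffop Da ad wd.
have cI : inv_diffop C (Pop k L i ^+ N * b) := mono_inv_diffop Dc cd wN.
have tI : inv_diffop C (theta k L i) :=
  mono_inv_diffop (@theta_diffop _ _ _ i) (theta_is_mono k L i)
    (@invariant_weight0 _ _ C).
pose a' : inv_diffops L C := Sub a aI.
pose c' : inv_diffops L C := Sub (Pop k L i ^+ N * b) cI.
pose t' : inv_diffops L C := Sub (theta k L i) tI.
have tD (s : k) : is_mono (theta k L i + s%:A) 0 (fun a => (a ord0 i)%:~R + s).
  have := is_mono_linear s (is_mono1 k L) (theta_is_mono k L i).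
  rewrite addrC; congr is_mono; apply/funext => u.
  by rewrite mulr1 addrC.
have prodE (f : 'I_N -> k) :
    val (\prod_(l < N) (t' + (f l)%:A)) =
    \prod_(l < N) (theta k L i + (f l)%:A).
  by rewrite rmorph_prod; apply: eq_bigr.
have prod_mono (f : 'I_N -> k) :
  is_mono (\prod_(l < N) (theta k L i + (f l)%:A)) 0
    (fun u => \prod_(l < N) ((u ord0 i)%:~R + f l)).
  by apply: is_mono_prod0 => l; exact: tD.
apply: (@no_fin_dim_module k k_char0 _ t' a' c' N N0); apply: val_inj.
- have := is_monoM (theta_is_mono k L i) ad; rewrite add0r => H1.
  have := is_monoM ad (tD N%:R); rewrite addr0 => H2.
  apply: (is_mono_uniq H1 H2) => u.
  by rewrite mul1r mulr1 mxE di rmorphD.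
- have := is_monoM (theta_is_mono k L i) cd; rewrite add0r => H1.
  have := is_monoM cd (tD (- N%:R)); rewrite addr0 => H2.
  apply: (is_mono_uniq H1 H2) => u; rewrite addr0 mulrC; congr (_ * _).
  by rewrite 2!mxE di rmorphD rmorphN.
- rewrite prodE; have := is_monoM cd ad; rewrite addNr => H1.
  apply: (is_mono_uniq H1 (prod_mono _)) => u.
  (* The factors u_i + N - l, read in reverse order, are u_i + l + 1. *)
  rewrite mulr1 (reindex_inj rev_ord_inj); apply: eq_bigr => l _ /=.
  rewrite mxE di rmorphD /= -addrA -natrB ?leq_subr //; congr (_ + _).
  by rewrite subKn.
- under eq_bigr => l _ do rewrite -scaleNr.
  rewrite prodE; have := is_monoM ad cd; rewrite subrr => H1.
  apply: (is_mono_uniq H1 (prod_mono _)) => u.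
  by rewrite mul1r.
Qed.
End NoFiniteDimensionalModule.

(** * Characters and the Zariski topology of tori *)

Section Characters.
Variables (k : fieldType) (m : nat).
Implicit Types (f : 'rV[k]_m -> k) (g h : 'rV[k]_m) (a : 'rV[int]_m).

Lemma Gm_dact g h : Gm k m g -> Gm k m h -> Gm k m (dact g h).
Proof. by move=> g0 h0 i; rewrite mxE mulf_neq0. Qed.

Lemma Gm_Gm1 : Gm k m (Gm1 k m).
Proof. by move=> i; rewrite mxE oner_neq0. Qed.

Lemma regular_Gm_monom f : regular_Gm f ->
  exists s : seq (k * 'rV[int]_m),
    forall g, Gm k m g -> f g = \sum_(ca <- s) ca.1 * monom g ca.2.
Proof.
move=> [p [e fE]].
exists [seq (p@_u, \row_i ((u i)%:Z - e%:Z)) | u <- msupp p] => g g0.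
rewrite fE // mevalE [RHS]big_map mulr_suml; apply: eq_bigr => u _ /=.
rewrite -mulrA; congr (_ * _); rewrite /monom -prodrXl -prodfV -big_split.
by apply: eq_bigr => i _; rewrite mxE expfzDr ?g0 //= -exprnN.
Qed.

(* Artin's argument for the linear independence of characters: a term of the
   sum that differs from [f] can be eliminated. *)
Lemma character_monom f (s : seq (k * 'rV[int]_m)) :
  (forall g h, Gm k m g -> Gm k m h -> f (dact g h) = f g * f h) ->
  (forall g, Gm k m g -> f g != 0) ->
  (forall g, Gm k m g -> f g = \sum_(ca <- s) ca.1 * monom g ca.2) ->
  exists a, forall g, Gm k m g -> f g = monom g a.
Proof.
move=> fM f0; have [N] := ubnP (size s); elim: N s => // N IH [|[c a] s] sN fs.
  by have := f0 _ Gm_Gm1; rewrite fs ?big_nil ?eqxx //; exact: Gm_Gm1.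
have [fa|] := pselect (forall g, Gm k m g -> f g = monom g a).
  by exists a.
move=> /existsNP[h /not_implyP[h0 /eqP fh]].
rewrite -subr_eq0 in fh; set z := _ - _ in fh.
(* Subtracting [monom h a] times the expansion of [f g] from that of [f (dact h g)] cancels the term
   of exponent [a] and leaves [z * f g] on the left. *)
apply: (IH [seq (z^-1 * (ca.1 * (monom h ca.2 - monom h a)), ca.2) | ca <- s]).
  by rewrite size_map.
move=> g g0; apply: (mulfI fh); rewrite big_map mulr_sumr /=.
rewrite {1}/z mulrBl -fM // fs; last exact: Gm_dact.
rewrite [f g]fs // !big_cons mulrDr opprD addrACA /= monom_dact.
rewrite [_ * (c * _)]mulrCA subrr add0r mulr_sumr -sumrB.
apply: eq_bigr => ca _; rewrite !mulrA mulfV // mul1r monom_dact.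
by rewrite mulrBr mulrBl mulrA [monom h a * _]mulrC.
Qed.

End Characters.

Section OneParameterSubgroups.
Variables (k : fieldType) (m : nat).
Implicit Types (z : k) (mu a : 'rV[int]_m).

Definition one_param z mu : 'rV[k]_m := \row_j z ^ mu ord0 j.

Definition pairing mu a : int := \sum_j mu ord0 j * a ord0 j.

Lemma Gm_one_param z mu : z != 0 -> Gm k m (one_param z mu).
Proof. by move=> z0 i; rewrite mxE expfz_neq0. Qed.

Lemma one_param1 mu : one_param 1 mu = Gm1 k m.
Proof. by apply/rowP => i; rewrite !mxE exp1rz. Qed.

Lemma prod_exprz (I : finType) z (e : I -> int) : z != 0 ->
  \prod_i z ^ e i = z ^ (\sum_i e i).
Proof.
move=> z0; rewrite (big_morph (exprz z) (id1 := 1) (op1 := *%R)) ?expr0z //.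
by move=> p q; exact: expfzDr.
Qed.

Lemma monom_one_param z mu a : z != 0 ->
  monom (one_param z mu) a = z ^ pairing mu a.
Proof.
move=> z0; rewrite -prod_exprz //; apply: eq_bigr => i _.
by rewrite mxE exprz_exp.
Qed.

(** Laurent polynomials on the nonzero scalars, with the denominator cleared; the value at 0 is left
    free. *)
Definition laurent (f : k -> k) := exists (q : {poly k}) (e : nat),
  forall z, z != 0 -> f z * z ^+ e = q.[z].

Lemma laurent_cst c : laurent (fun=> c).
Proof. by exists c%:P, 0%N => z _; rewrite hornerC expr0 mulr1. Qed.

Lemma laurentD f g : laurent f -> laurent g -> laurent (fun z => f z + g z).
Proof.
move=> [p [d fp]] [q [e gq]]; exists (p * 'X^e + q * 'X^d), (d + e)%N => z z0.
rewrite hornerD !hornerM !hornerXn -fp // -gq // mulrDl exprD !mulrA.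
by rewrite [g z * _ * _]mulrAC.
Qed.

Lemma laurentM f g : laurent f -> laurent g -> laurent (fun z => f z * g z).
Proof.
move=> [p [d fp]] [q [e gq]]; exists (p * q), (d + e)%N => z z0.
by rewrite hornerM -fp // -gq // exprD mulrACA.
Qed.

Lemma laurent_exprz (e : int) : laurent (fun z => z ^ e).
Proof.
case: e => e; first by exists 'X^e, 0%N => z _; rewrite hornerXn mulr1.
exists 1, e.+1 => z z0; rewrite hornerC NegzE -exprnN.
by rewrite mulVf // expf_neq0.
Qed.

Lemma laurent_meval (p : {mpoly k[m]}) mu :
  laurent (fun z => p.@[one_param z mu ord0]).
Proof.
have -> : (fun z => p.@[one_param z mu ord0]) = (fun z =>
    \sum_(u <- msupp p) p@_u * \prod_i one_param z mu ord0 i ^+ u i).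
  by apply/funext => z; rewrite mevalE.
elim: (msupp p) => [|u r IH].
  have := laurent_cst 0; congr laurent.
  by apply/funext => z; rewrite big_nil.
have : laurent (fun z => p@_u * \prod_i one_param z mu ord0 i ^+ u i).
  apply: laurentM; first exact: laurent_cst.
  elim: (index_enum _) => [|i s IHs].
    have := laurent_cst 1; congr laurent.
    by apply/funext => z; rewrite big_nil.
  have := laurentM (laurent_exprz (mu ord0 i * u i)) IHs; congr laurent.
  by apply/funext => z; rewrite big_cons mxE -exprz_exp.
move=> /laurentD/(_ IH); congr laurent.
by apply/funext => z; rewrite big_cons.
Qed.

Hypothesis k_char0 : [pchar k] =i pred0.

(** Irreducibility of the multiplicative group: the product of the two numerators is a nonzero
    polynomial, so some positive integer is not a root of it. *)
Lemma laurent_nonzero f g z1 z2 : laurent f -> laurent g ->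
  z1 != 0 -> f z1 != 0 -> z2 != 0 -> g z2 != 0 ->
  exists z, [/\ z != 0, f z != 0 & g z != 0].
Proof.
move=> [p [d fp]] [q [e gq]] z10 f1 z20 g2.
have p0 : p != 0.
  apply: contraNneq f1 => p0; have /eqP := fp _ z10.
  by rewrite p0 horner0 mulf_eq0 expf_eq0 (negPf z10) andbF orbF.
have q0 : q != 0.
  apply: contraNneq g2 => q0; have /eqP := gq _ z20.
  by rewrite q0 horner0 mulf_eq0 expf_eq0 (negPf z20) andbF orbF.
have [t t1] := poly_natr_nonroot k_char0 0 1 (mulf_neq0 p0 q0) (oner_neq0 k).
rewrite add0r hornerM mulf_eq0 negb_or => /andP[pt qt].
have z0 : t%:R != 0 :> k by rewrite pchar0_natr_eq0 // -lt0n.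
exists t%:R; split=> //.
  by apply: contraNneq pt => ft; rewrite -fp // ft mul0r.
by apply: contraNneq qt => gt; rewrite -gq // gt mul0r.
Qed.

(** A clopen part and its complement are both given by the nonvanishing of polynomials, which become
    Laurent polynomials in [z]; if both parts were nonempty they would share a point. *)
Lemma connected_one_param mu :
  connected ([set one_param z mu | z in [set z | z != 0]] : set (zariski k m)).
Proof.
move=> B [b0 Bb0] [U Uo BU] [D Dc BD]; rewrite BU.
have [S US] := (zariski_openP U).1 Uo.
have [S' DS'] := (zariski_openP (~` D)).1 (closed_openC Dc).
have : B b0 by []; rewrite BU => -[[z1 z10 z1b] /US[p Sp pb]].
apply/seteqP; split=> [x []//|x Gx]; split=> //; apply: contrapT => nUx.
have : ~ B x by rewrite BU => -[].
rewrite BD => nDx; have /DS'[p' Sp' p'x] : (~` D) x by move=> Dx; apply: nDx.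
case: (Gx) => z2 z20 z2x; rewrite -z1b in pb; rewrite -z2x in p'x.
have [z [z0 pz p'z]] := laurent_nonzero (laurent_meval p mu)
  (laurent_meval p' mu) z10 pb z20 p'x.
have : B (one_param z mu) by rewrite BU; split; [exists z|apply/US; exists p].
by rewrite BD => -[_]; apply/DS'; exists p'.
Qed.

(** The scalar 2 has infinite order in characteristic 0, so testing a one-parameter subgroup at
    [z = 2] detects a trivial exponent. *)
Lemma exprz2_eq1 (e : int) : 2%:R ^ e = 1 :> k -> e = 0.
Proof.
have pow2 (d : nat) : 2%:R ^+ d = 1 :> k -> d = 0%N.
  rewrite -natrX => E.
  have [] : Posz (2 ^ d) = Posz 1 by apply: (pchar0_intr_inj k_char0); exact: E.
  by case: d {E} => // d; rewrite expnS; case: (2 ^ d)%N => // [[]].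
case: e => e; first by move=> /pow2 ->.
by rewrite NegzE -exprnN => /(congr1 GRing.inv); rewrite invrK invr1 => /pow2.
Qed.

Lemma one_param_weight mu a :
  (forall z, z != 0 -> monom (one_param z mu) a = 1) -> pairing mu a = 0.
Proof.
have k2 : 2%:R != 0 :> k by rewrite pchar0_natr_eq0.
by move/(_ _ k2); rewrite monom_one_param //; exact: exprz2_eq1.
Qed.

End OneParameterSubgroups.

(* Since [f ^+ N = 1], the closed locus [f = 1] is also the open locus where
   the sum of the [f ^+ l], [l < N], does not vanish. *)
Lemma id_component_root_of_unity (k : fieldType) (k_char0 : [pchar k] =i pred0)
    (m : nat) (H : set 'rV[k]_m) (f : 'rV[k]_m -> k) (N : nat) :
  (0 < N)%N -> regular_Gm f -> H `<=` Gm k m -> H (Gm1 k m) ->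
  f (Gm1 k m) = 1 -> (forall h, H h -> f h ^+ N = 1) ->
  forall h, id_component H h -> f h = 1.
Proof.
move=> N0 [p [e fE]] HG H1 f1 fN.
pose q : {mpoly k[m]} := (\prod_i 'X_i) ^+ e.
have qE g : q.@[g ord0] = (\prod_i g ord0 i) ^+ e.
  rewrite rmorphXn rmorph_prod /=; congr (_ ^+ _).
  by apply: eq_bigr => i _; rewrite mevalXU.
have q0 g : Gm k m g -> q.@[g ord0] != 0.
  by move=> g0; rewrite qE expf_neq0 //; apply/prodf_neq0 => i _; exact: g0.
(* With [f] written as p / q, this is the sum of its powers cleared of denominators: p^N - q^N = (p
   - q) S. *)
pose S : {mpoly k[m]} := \sum_(l < N) p ^+ (N.-1 - l) * q ^+ l.
have SE g : S.@[g ord0] =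
    \sum_(l < N) p.@[g ord0] ^+ (N.-1 - l) * q.@[g ord0] ^+ l.
  by rewrite raddf_sum; apply: eq_bigr => l _; rewrite /= mevalM !rmorphXn.
have Ho_sub : id_component H `<=` H :=
  @connected_component_sub (zariski k m) H (Gm1 k m).
have f1E g : H g -> (f g = 1) <-> (p - q).@[g ord0] = 0.
  move=> /HG g0; rewrite fE // -qE mevalB; split=> [/divr1_eq->|/subr0_eq->].
    by rewrite subrr.
  by rewrite mulfV // q0.
have SN g : H g -> (f g = 1) <-> S.@[g ord0] != 0.
  move=> Hg; have g0 := HG _ Hg; split=> [/(f1E _ Hg)|S0].
    rewrite mevalB SE => /subr0_eq->.
    have E (l : 'I_N) : q.@[g ord0] ^+ (N.-1 - l) * q.@[g ord0] ^+ l =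
        q.@[g ord0] ^+ N.-1.
      by rewrite -exprD subnK // -ltnS prednK.
    rewrite (eq_bigr _ (fun l _ => E l)) sumr_const card_ord -mulr_natr.
    by rewrite mulf_neq0 ?expf_neq0 ?q0 // pchar0_natr_eq0 // -lt0n.
  apply/(f1E _ Hg); apply: (mulIf S0); rewrite mul0r mevalB SE -subrXX.
  have := fN _ Hg; rewrite fE // -qE expr_div_n => /divr1_eq->.
  by rewrite subrr.
pose B := id_component H `&` [set g | f g = 1].
suff <- : B = id_component H by move=> h [].
apply: (@component_connected (zariski k m) H (Gm1 k m)).
- exists (Gm1 k m); split=> //.
  exact: (@connected_component_refl (zariski k m)).
- exists [set g : zariski k m | S.@[(g : 'rV[k]_m) ord0] != 0].
    apply/zariski_openP; exists [set S] => x; split=> [Sx|[_ -> //]].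
    by exists S.
  by apply/seteqP; split=> g [Hg fg]; split=> //; exact/(SN _ (Ho_sub _ Hg)).
- exists [set g : zariski k m | (p - q).@[(g : 'rV[k]_m) ord0] = 0].
    rewrite -openC; apply/zariski_openP; exists [set p - q] => x; split.
      by move=> /eqP Sx; exists (p - q).
    by move=> [_ -> /eqP].
  by apply/seteqP; split=> g [Hg fg]; split=> //; exact/(f1E _ (Ho_sub _ Hg)).
Qed.

(** * Integral linear algebra *)

Lemma rat_mx_denominator p q (v : 'M[rat]_(p, q)) :
  exists2 N : nat, (0 < N)%N &
    exists w : 'M[int]_(p, q), N%:R *: v = map_mx intr w.
Proof.
pose N := (\prod_(ij : 'I_p * 'I_q) `|denq (v ij.1 ij.2)|)%N.
exists N; first by rewrite prodn_gt0 // => ij; rewrite absz_gt0 denq_neq0.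
have /choice[w wE] ij : exists t : int, N%:R * v ij.1 ij.2 = t%:~R.
  rewrite /N (bigD1 ij) //=; set R := (\prod_(_ | _) _)%N.
  exists (R%:Z * numq (v ij.1 ij.2)); rewrite natrM intrM numqE -pmulrn.
  rewrite mulrAC mulrC; congr (_ * _); rewrite mulrC; congr (_ * _).
  by rewrite pmulrn gez0_abs // denq_ge0.
exists (\matrix_(i, j) w (i, j)); apply/matrixP => i j.
by rewrite !mxE -(wE (i, j)).
Qed.

(* Over Q, an A_i outside the span of the B_j is separated from it by a linear
   form; the forms are then combined with the powers of an integer as
   coefficients. *)
Lemma separating_or_dependent m r s (A : 'I_r -> 'rV[int]_m)
    (B : 'I_s -> 'rV[int]_m) :
  (exists mu, (forall j, pairing mu (B j) = 0) /\
     forall i, pairing mu (A i) != 0) \/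
  (exists i (N : nat) (c : 'I_s -> int), (0 < N)%N /\
     A i *+ N = \sum_j c j *: B j).
Proof.
pose toQ (a : 'rV[int]_m) : 'rV[rat]_m := map_mx intr a.
pose BQ : 'M[rat]_(s, m) := \matrix_j toQ (B j).
have [[i iB]|nB] := pselect (exists i, (toQ (A i) <= BQ)%MS).
  right; exists i; have /submxP[c cE] := iB.
  have [N N0 [w wE]] := rat_mx_denominator c.
  exists N, (w ord0); split=> //.
  apply/rowP => l; apply: (@intr_inj rat).
  move/rowP/(_ l): cE; rewrite !mxE => cE.
  rewrite mulmxnE rmorphMn /= cE -mulr_natl mulr_sumr summxE rmorph_sum.
  apply: eq_bigr => j _; rewrite !mxE rmorphM mulrA; congr (_ * _).
  by have /matrixP/(_ ord0 j) := wE; rewrite !mxE.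
left; pose K := cokermx BQ.
pose w i := toQ (A i) *m K.
have w0 i : w i != 0.
  by apply/negP => /eqP wi; apply: nB; exists i; rewrite submxE; apply/eqP.
(* Read as polynomials, the [w i] have a common non-root [t] among the natural numbers; the column
   of powers of [t] then pairs nontrivially with each of them. *)
pose P := \prod_i rVpoly (w i).
have P0 : P != 0.
  apply/prodf_neq0 => i _; apply: contra_neq (w0 i) => wi.
  by rewrite -[w i]rVpolyK wi linear0.
have [t _ Pt] := poly_natr_nonroot (pchar_num _) 0 0 P0 (oner_neq0 rat).
rewrite add0r in Pt.
pose v : 'cV[rat]_m := \col_l t%:R ^+ l.
have [N N0 [mu muE]] := rat_mx_denominator (K *m v)^T.
have pairE (a : 'rV[int]_m) :
  (pairing mu a)%:~R = N%:R * (toQ a *m K *m v) ord0 ord0.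
  rewrite -mulmxA [in RHS]mxE mulr_sumr rmorph_sum; apply: eq_bigr => l _.
  have muEl : (mu ord0 l)%:~R = N%:R * (K *m v) l ord0.
    have /matrixP/(_ ord0 l) := muE; rewrite [RHS]mxE => <-.
    by rewrite mxE [_^T _ _]mxE.
  by rewrite rmorphM /= muEl [toQ a _ _]mxE -mulrA [(_ l _ * _)]mulrC.
exists mu; split=> [j|i].
  apply: (@intr_inj rat); rewrite pairE.
  have -> : toQ (B j) = row j BQ by rewrite rowK.
  by rewrite -row_mul mulmx_coker row0 mul0mx mxE mulr0.
rewrite -(intr_eq0 rat) pairE mulf_neq0 ?pnatr_eq0 -?lt0n //.
have : (rVpoly (w i)).[t%:R] != 0.
  by move: Pt; rewrite horner_prod => /prodf_neq0; apply.
rewrite (@horner_coef_wide _ m) ?size_poly //; congr (_ != 0).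
rewrite mxE; apply: eq_bigr => l _.
by rewrite coef_rVpoly_ord !mxE.
Qed.

(** * Diagonal torus actions *)

(** If there were no such module, 1 would vacuously annihilate all the simple ones, giving 1 = 0. *)
Lemma enough_simple_nonzero_module (k : fieldType) (R : algType k) :
  enough_simple_fin_dim R -> exists M : lmodType R, fin_dim M /\ nonzero_mod M.
Proof.
move=> enough; apply: contrapT => nex; have /eqP := oner_neq0 R; apply.
by apply: enough => M [Mnz _] Mfin; exfalso; apply: nex; exists M.
Qed.

Lemma torus_embedding_monom (k : fieldType) m n (phi : 'rV[k]_m -> 'rV[k]_n) :
  torus_embedding phi ->
  exists A : 'I_n -> 'rV[int]_m,
    forall g i, Gm k m g -> phi g ord0 i = monom g (A i).
Proof.
move=> [phi_reg phi_Gm phiM _].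
suff /choice[A AP] i : exists a, forall g, Gm k m g -> phi g ord0 i = monom g a.
  by exists A => g i; exact: AP.
have [s fs] := regular_Gm_monom (phi_reg i).
apply: character_monom fs => [g h g0 h0|g g0]; first by rewrite phiM // mxE.
exact: phi_Gm.
Qed.

Lemma lshift_inverted r s (i : 'I_r) : lshift s i \notin inverted r s.
Proof. by rewrite inE /= -ltnNge ltn_ord. Qed.

Lemma rshift_inverted r s (j : 'I_s) : rshift r j \in inverted r s.
Proof. by rewrite inE /= leq_addr. Qed.

Section DiagonalTorus.
Variables (k : closedFieldType) (k_char0 : [pchar k] =i pred0).
Variables (r s m : nat) (phi : 'rV[k]_m -> 'rV[k]_(r + s)).
Hypothesis phi_emb : torus_embedding phi.
Variables (w : 'rV[k]_s) (w_in_W : Gm k s w).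
Variable A : 'I_(r + s) -> 'rV[int]_m.
Hypothesis AP : forall g i, Gm k m g -> phi g ord0 i = monom g (A i).

Local Notation H := (stabilizer (fun g => rsubmx (phi g)) w).
Local Notation Ho_on_V := [set lsubmx (phi h) | h in id_component H].

(** No coordinate of [w] vanishes, so the stabilizer is the kernel of the action on W. *)
Lemma stabilizerP g : Gm k m g ->
  H g <-> forall j, phi g ord0 (rshift r j) = 1.
Proof.
move=> g0; split=> [[_ /rowP gw] j|g1].
  have := gw j; rewrite !mxE -[RHS]mul1r; apply: mulIf; exact: w_in_W.
by split=> //; apply/rowP => j; rewrite !mxE g1 mul1r.
Qed.

Lemma stabilizer1 : H (Gm1 k m).
Proof.
apply/stabilizerP => [|j]; first exact: Gm_Gm1.
rewrite AP; last exact: Gm_Gm1.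
by rewrite /monom big1 // => i _; rewrite mxE exp1rz.
Qed.

(** * A one-parameter subgroup of the stabilizer with nonzero weights on V *)

Section Separated.
Variable mu : 'rV[int]_m.
Hypothesis mu_W : forall j, pairing mu (A (rshift r j)) = 0.
Hypothesis mu_V : forall i, pairing mu (A (lshift s i)) != 0.

Lemma phi_one_param z : z != 0 ->
  phi (one_param z mu) = one_param z (\row_i pairing mu (A i)).
Proof.
move=> z0; apply/rowP => i; rewrite AP; last exact: Gm_one_param.
by rewrite monom_one_param // !mxE.
Qed.

(** The image of the one-parameter subgroup is connected, contains the identity and lies in [H],
    because [mu] is orthogonal to the weights of W. *)
Lemma one_param_id_component z : z != 0 -> id_component H (one_param z mu).
Proof.
move=> z0; apply: (@connected_component_max (zariski k m) H
  [set one_param z mu | z in [set z | z != 0]] (Gm1 k m)).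
- by exists 1; [exact: oner_neq0|exact: one_param1].
- move=> _ [t t0 <-]; apply/stabilizerP => [|j]; first exact: Gm_one_param.
  by rewrite phi_one_param // !mxE mu_W expr0z.
- exact: connected_one_param.
- by exists z.
Qed.

Lemma separated_fixed_points : fixed_points Ho_on_V = [set 0].
Proof.
apply/seteqP; split=> [v vfix|_ -> c _]; last first.
  by apply/rowP => i; rewrite !mxE mulr0.
apply/rowP => i; rewrite [RHS]mxE; apply: contrapT => /eqP vi.
case/negP: (mu_V i); apply/eqP; apply: (exprz2_eq1 k_char0).
have k2 : 2%:R != 0 :> k by rewrite pchar0_natr_eq0.
have Ho2 : Ho_on_V (lsubmx (phi (one_param 2%:R mu))).
  by exists (one_param 2%:R mu) => //; exact: one_param_id_component.
have /rowP/(_ i) := vfix _ Ho2; rewrite mxE mxE phi_one_param // !mxE.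
by rewrite -[RHS]mul1r => /(mulIf vi).
Qed.

Lemma separated_DV : enough_simple_fin_dim (DV_inv Ho_on_V).
Proof.
apply: (enough_simple_fin_dim_weights k_char0
  (mu := fun i => pairing mu (A (lshift s i)))) => [i _|d wd|d _ d0] //.
  rewrite -[RHS](@one_param_weight k r k_char0
    (\row_i pairing mu (A (lshift s i))) d) => [|z z0].
    by apply: eq_big => [i|i _]; rewrite ?inE // mxE.
  have <- : lsubmx (phi (one_param z mu)) =
      one_param z (\row_i pairing mu (A (lshift s i))).
    by apply/rowP => i; rewrite phi_one_param // !mxE.
  apply: wd.
    by exists (one_param z mu) => //; exact: one_param_id_component.
  by move=> i; rewrite phi_one_param // !mxE expfz_neq0.
by apply/rowP => i; rewrite mxE d0 // inE.
Qed.

Lemma separated_DY : transitive_on (fun g => rsubmx (phi g)) ->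
  enough_simple_fin_dim (DY_inv (phi @` Gm k m)).
Proof.
move=> trans_W; apply: (enough_simple_fin_dim_weights k_char0
  (mu := fun i => pairing mu (A i))) => [i iL|d wd|d wd d0].
- case: (split_ordP i) iL => j -> //; by rewrite rshift_inverted.
- rewrite -[RHS](@one_param_weight k (r + s) k_char0
    (\row_i pairing mu (A i)) d) => [|z z0].
    rewrite big_mkcond; apply: eq_bigr => i _; rewrite mxE.
    case: (split_ordP i) => j ->; first by rewrite lshift_inverted.
    by rewrite rshift_inverted mu_W mul0r.
  rewrite -phi_one_param //; apply: wd.
    by exists (one_param z mu) => //; exact: Gm_one_param.
  by case: phi_emb => _ + _ _; apply; exact: Gm_one_param.
- apply/rowP => i; rewrite [RHS]mxE.
  case: (split_ordP i) => j ->; first by rewrite d0 // lshift_inverted.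
  have k2 : 2%:R != 0 :> k by rewrite pchar0_natr_eq0.
  (* Transitivity provides [g] acting on W by 2 in coordinate [j] and by 1 in the others; invariance
     of [d] under [g] then makes its entry at [j] zero. *)
  have [|g g0 gE] := trans_W _ (one_param 2%:R (delta_mx ord0 j)) (@Gm_Gm1 k s).
    exact: Gm_one_param.
  have gj l : phi g ord0 (rshift r l) = 2%:R ^ (l == j : int).
    by have /rowP/(_ l) := gE; rewrite !mxE mulr1 eqxx natz => ->.
  have : monom (phi g) d = 1.
    by apply: wd; [exists g|case: phi_emb => _ + _ _; exact].
  rewrite /monom big_split_ord /= big1 => [|l _]; last first.
    by rewrite d0 ?lshift_inverted // expr0z.
  rewrite mul1r (bigD1 j) //= big1 => [|l /negPf lj].
    by rewrite mulr1 gj eqxx expr1z => /(exprz2_eq1 k_char0).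
  by rewrite gj lj expr0z exp1rz.
Qed.

End Separated.

(** * A weight of V with a multiple in the span of the weights of W *)

Section Dependent.
Variables (i : 'I_r) (N : nat) (c : 'I_s -> int).
Hypothesis N0 : (0 < N)%N.
Hypothesis Ac : A (lshift s i) *+ N = \sum_j c j *: A (rshift r j).

(** On [H] the [N]-th power of this character is a product of powers of the weights of W, which are
    trivial there, so its values are roots of unity. *)
Lemma dependent_id_component h :
  id_component H h -> phi h ord0 (lshift s i) = 1.
Proof.
case: phi_emb => phi_reg _ _ _.
apply: (id_component_root_of_unity k_char0
  (f := fun g => phi g ord0 (lshift s i)) N0).
- exact: phi_reg.
- by move=> g [].
- exact: stabilizer1.
- rewrite AP; last exact: Gm_Gm1.
  by rewrite /monom big1 // => j _; rewrite mxE exp1rz.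
- move=> g Hg; have g0 : Gm k m g by case: Hg.
  rewrite AP // exprnP -monomZ -natz scaler_nat Ac -monom_lincomb //.
  rewrite big1 // => j _.
  by rewrite -AP // (stabilizerP g0).1 // exp1rz.
Qed.

Lemma dependent_fixed_points : fixed_points Ho_on_V <> [set 0].
Proof.
move=> /seteqP[fix0 _].
have /fix0/rowP/(_ i) : fixed_points Ho_on_V (delta_mx ord0 i).
  move=> _ [h Hoh <-]; apply/rowP => j; rewrite !mxE eqxx /=.
  have [->|_] := eqVneq j i; last by rewrite mulr0.
  by rewrite dependent_id_component // mulr1.
by rewrite !mxE !eqxx => /eqP; rewrite oner_eq0.
Qed.

(** [H^o] acts trivially on the coordinate [i], so the criterion applies with exponent 1 and [d] the
    unit vector. *)
Lemma dependent_DV : ~ enough_simple_fin_dim (DV_inv Ho_on_V).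
Proof.
move=> /enough_simple_nonzero_module[M [Mfin]].
apply: (@no_fin_dim_inv_diffops k k_char0 r finset.set0 Ho_on_V i 1
  (delta_mx ord0 i)) => //.
- by rewrite mxE !eqxx.
- by move=> j _; rewrite mxE ler0n.
- by move=> j _ /negPf ji; rewrite mxE ji andbF.
- move=> _ [h Hoh <-] _; rewrite -[delta_mx _ _]scale1r monom_delta mxE.
  by rewrite dependent_id_component // expr1z.
Qed.

Lemma dependent_DY :
  ~ exists M : lmodType (DY_inv (phi @` Gm k m)), fin_dim M /\ nonzero_mod M.
Proof.
move=> [M [Mfin]].
(* The degree of Q_i^N Q_W^(-c), whose weight under the torus is zero by [Ac]. *)
pose d : 'rV[int]_(r + s) := row_mx (\row_j (N * (j == i))%:Z) (\row_j - c j).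
have dl j : d ord0 (lshift s j) = (N * (j == i))%N by rewrite row_mxEl mxE.
have dr j : d ord0 (rshift r j) = - c j by rewrite row_mxEr mxE.
apply: (@no_fin_dim_inv_diffops k k_char0 _ (inverted r s) _
  (lshift s i) N d) => //.
- by rewrite dl eqxx muln1.
- by move=> j; case: (split_ordP j) => l -> //; rewrite ?rshift_inverted ?dl.
- move=> j; case: (split_ordP j) => l ->; last by rewrite rshift_inverted.
  by rewrite dl (inj_eq (@lshift_inj _ _)) => _ /negPf->; rewrite muln0.
- move=> _ [g g0 <-] _; transitivity (\prod_l monom g (A l) ^ d ord0 l).
    by apply: eq_bigr => l _; rewrite AP.
  rewrite monom_lincomb // big_split_ord /=.
  have -> : \sum_j d ord0 (lshift s j) *: A (lshift s j) = A (lshift s i) *+ N.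
    rewrite (bigD1 i) //= big1 => [|j /negPf ji].
      by rewrite dl eqxx muln1 addr0 -natz scaler_nat.
    by rewrite dl ji muln0 scale0r.
  rewrite Ac -big_split /= big1 ?monom0 // => j _.
  by rewrite dr scaleNr subrr.
Qed.

End Dependent.

End DiagonalTorus.

Theorem theoremB (k : closedFieldType) (k_char0 : [pchar k] =i pred0)
    (r s m : nat) (phi : 'rV[k]_m -> 'rV[k]_(r + s))
    (phi_emb : torus_embedding phi)
    (trans_W : transitive_on (fun g => rsubmx (phi g)))
    (w : 'rV[k]_s) (w_in_W : Gm k s w) :
  let H := stabilizer (fun g => rsubmx (phi g)) w in
  let Ho_on_V := [set lsubmx (phi h) | h in id_component H] in
  [<-> fixed_points Ho_on_V = [set 0];
       enough_simple_fin_dim (DV_inv Ho_on_V);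
       exists M : lmodType (DY_inv (phi @` Gm k m)), fin_dim M /\ nonzero_mod M;
       enough_simple_fin_dim (DY_inv (phi @` Gm k m))].
Proof.
move=> H Ho_on_V; have [A AP] := torus_embedding_monom phi_emb.
(* In the first alternative all four conditions hold, in the second all four fail. *)
have [[mu [muW muV]]|[i [N [c [N0 Ac]]]]] := separating_or_dependent
  (fun i => A (lshift s i)) (fun j => A (rshift r j)).
  have F := separated_fixed_points k_char0 w_in_W AP muW muV.
  have V := separated_DV k_char0 w_in_W AP muW muV.
  have Y := separated_DY k_char0 phi_emb AP muW muV trans_W.
  by tfae=> _; [exact: V|exact: enough_simple_nonzero_module|exact: Y|exact: F].
have nF := dependent_fixed_points k_char0 phi_emb w_in_W AP N0 Ac.
have nV := dependent_DV k_char0 phi_emb w_in_W AP N0 Ac.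
have nM := dependent_DY k_char0 AP N0 Ac.
by tfae=> [/nF|/nV|/nM|/enough_simple_nonzero_module/nM].
Qed.
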